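(* Let $\mathbf{A}\in\mathbb{R}^{n\times m}$ with $m>n$ be a deterministic matrix whose columns $\mathbf{a}_1,\dots,\mathbf{a}_m$ satisfy $\|\mathbf{a}_i\|_2=1$, and let $\mu$ be its mutual coherence. Let $\mathbf{x}_0\in\mathbb{R}^m$ be a deterministic vector with sparsity $\|\mathbf{x}_0\|_0=s$, and let $\mathbf{b}=\mathbf{A}\mathbf{x}_0+\mathbf{w}$, where $\mathbf{w}\sim N(\mathbf{0},\sigma^2\mathbf{I})$ is a random noise vector in $\mathbb{R}^n$, $\sigma>0$. Suppose that $s<\frac{1}{3\mu}$. Let $\alpha>0$ and let $\hat{\mathbf{x}}_{\mathrm{BP}}$ be a solution of $$\min_{\mathbf{x}\in\mathbb{R}^m}\ \tfrac12\|\mathbf{b}-\mathbf{A}\mathbf{x}\|_2^2+\gamma\|\mathbf{x}\|_1\qquad\text{with}\qquad \gamma=\sqrt{8\sigma^2(1+\alpha)\log(m-s)}.$$ Then, with probability exceeding $$\left(1-\frac{1}{(m-s)^\alpha}\right)\left(1-e^{-s/7}\right),$$ we have $$\|\mathbf{x}_0-\hat{\mathbf{x}}_{\mathrm{BP}}\|_2^2\le\left(\sqrt3+3\sqrt{2(1+\alpha)\log(m-s)}\right)^2 s\sigma^2.$$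
   Context: $\|\mathbf{x}\|_0$ denotes the number of nonzero entries of $\mathbf{x}$. The mutual coherence of a matrix $\mathbf{A}$ with columns $\mathbf{a}_1,\dots,\mathbf{a}_m$ is $\mu=\max_{i\neq j}|\mathbf{a}_i^T\mathbf{a}_j|$. The optimization problem in the claim is called basis pursuit denoising (BPDN). Logarithms are natural. Probability is with respect to the noise $\mathbf{w}$. *)

(* Defs.v *)
From HB Require Import structures.
From mathcomp Require Export all_boot all_order all_algebra.
From mathcomp Require Export all_classical all_reals all_analysis.

Set Implicit Arguments.
Unset Strict Implicit.
Unset Printing Implicit Defensive.

Import Order.TTheory GRing.Theory Num.Theory.
Import numFieldNormedType.Exports.

Local Open Scope classical_set_scope.
Local Open Scope ring_scope.

Definition l0norm (R : realType) (k : nat) (x : 'cV[R]_k) : nat :=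
  #|[set i : 'I_k | x i 0 != 0]%SET|.

(* The library norm on matrices is the sup norm, hence these two definitions. *)
Definition l1norm (R : realType) (k : nat) (x : 'cV[R]_k) : R :=
  \sum_(i < k) `|x i 0|.

Definition l2norm (R : realType) (k : nat) (x : 'cV[R]_k) : R :=
  Num.sqrt (\sum_(i < k) x i 0 ^+ 2).

(* The maximum is taken over nonnegative numbers, so the default value 0 only
   matters when there is no pair of distinct columns. *)
Definition mutual_coherence (R : realType) (n m : nat) (A : 'M[R]_(n, m)) : R :=
  \big[Num.max/0]_(p : 'I_m * 'I_m | p.1 != p.2)
    `|((col p.1 A)^T *m col p.2 A) 0 0|.

Definition bpdn_objective (R : realType) (n m : nat) (A : 'M[R]_(n, m))
    (b : 'cV[R]_n) (gamma : R) (x : 'cV[R]_m) : R :=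
  2^-1 * l2norm (b - A *m x) ^+ 2 + gamma * l1norm x.

(* Minimizers need not be unique. *)
Definition is_bpdn_solution (R : realType) (n m : nat) (A : 'M[R]_(n, m))
    (b : 'cV[R]_n) (gamma : R) (xhat : 'cV[R]_m) : Prop :=
  forall x : 'cV[R]_m,
    bpdn_objective A b gamma xhat <= bpdn_objective A b gamma x.

(* The product rule over a proper subfamily is the case where B i = setT for
   the remaining indices. *)
Definition mutually_independent (R : realType) (d : measure_display)
    (T : measurableType d) (P : probability T R) (I : finType)
    (W : I -> {RV P >-> R}) : Prop :=
  forall B : I -> set R, (forall i, measurable (B i)) ->
    P [set t | forall i, B i (W i t)] = (\prod_(i : I) P (W i @^-1` B i))%E.

(* The vector with components W i is distributed as N(0, sigma^2 I);
   the second argument of normal_prob is the standard deviation. *)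
Definition white_gaussian (R : realType) (d : measure_display)
    (T : measurableType d) (P : probability T R) (n : nat)
    (W : 'I_n -> {RV P >-> R}) (sigma : R) : Prop :=
  (forall (i : 'I_n) (B : set R), measurable B ->
     distribution P (W i) B = normal_prob 0 sigma B) /\
  mutually_independent W.

(* A minimizer is chosen at each sample point with no measurability
   requirement, so Q need not be an event; for a non-measurable Q this says
   that the inner probability of Q exceeds p. *)
Definition holds_with_prob_gt (R : realType) (d : measure_display)
    (T : measurableType d) (P : probability T R) (p : R) (Q : set T) : Prop :=
  exists E : set T, [/\ measurable E, E `<=` Q & (p%:E < P E)%E].

Lemma holds_with_prob_gtE (R : realType) (d : measure_display)
    (T : measurableType d) (P : probability T R) (p : R) (Q : set T) :
  measurable Q -> holds_with_prob_gt P p Q <-> (p%:E < P Q)%E.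
Proof.
move=> mQ; split=> [[E [mE EQ pE]]|pQ]; last by exists Q; split.
by apply: (lt_le_trans pE); rewrite le_measure ?inE.
Qed.

(* Main.v *)
Require Import Defs.
From HB Require Import structures.
From mathcomp Require Import all_boot all_order all_algebra.
From mathcomp Require Import all_classical all_reals all_analysis.
From mathcomp Require Import measurable_realfun.
From mathcomp Require Import zify ring lra.

Set Implicit Arguments.
Unset Strict Implicit.
Unset Printing Implicit Defensive.

Import Order.TTheory GRing.Theory Num.Theory.
Import numFieldNormedType.Exports.

Local Open Scope classical_set_scope.
Local Open Scope ring_scope.

(** Let L be the support of x0, let Q be the orthogonal projection onto the
    span of the columns a_i with i in L, and put
    x = sqrt (2 (1 + alpha) ln (m - s)), so that gamma = 2 x sigma.

    The deterministic half is [bpdn_solution_error]: the error bound holds as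
    soon as the noise w satisfies
    - |<a_i - Q a_i, w>| <= x sigma = gamma / 2 for every i outside L, and
    - |Q w|^2 <= 2 s sigma^2.
    Indeed 3 s mu < 1 makes the Gram matrix of the columns in L diagonally
    dominant. If z is the part of a minimizer outside L, replacing z by the
    coefficients y of Q (A z) on L changes the objective by at least
    gamma (|z|_1 - |y|_1) - (gamma / 2) |z|_1 in favour of the new point, and
    |y|_1 < |z|_1 / 2 unless z = 0; hence z = 0. Stationarity then says that
    the minimizer differs from the least squares estimate on L by at most
    (3/2) gamma sqrt s, and the least squares estimate differs from x0 by at
    most sqrt (3 s) sigma.

    The probabilistic half bounds the two exceptional events. A linear form
    in w is Gaussian ([linear_combination_joint]), so the Mills inequality
    ([normal_prob_tail]) and a union bound give the first one a probability
    at most r a, where a = (m - s)^(- alpha) and r = sqrt (2 / pi) / x. For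
    the second one the exponential moments of |Q w|^2
    ([dot_noise_sqr_mgf]) give a probability p.

    The product (1 - a) (1 - exp (- s / 7)) in the claim suggests
    independence of the two events, but a union bound suffices, because both
    tail bounds have room to spare: with b = exp (- s / 7),
      1 - r a - p - (1 - a) (1 - b) = (1 - a) (b - p) + a (1 - r - p),
    and this is positive once p < b and r + p <= 1. The Chernoff bound
    (2 / e)^(s / 2) gives p < b. For r + p <= 1, Markov's inequality gives
    p <= 0.503, while r <= 0.497 needs a lower bound on m: any 3 s + 1 columns
    of A are independent ([coherence_sparsity_dim]), so m >= 3 s + 2, hence
    m - s >= 4 when s > 0. When s = 0 one has p = 0 and m >= 2, which gives
    r < 1. *)

(** * Scalar products of column vectors *)

Definition dot (R : realType) (k : nat) (u v : 'cV[R]_k) : R :=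
  \sum_(i < k) u i 0 * v i 0.

Section dot_theory.
Context (R : realType) (k : nat).
Implicit Types u v x : 'cV[R]_k.

Lemma dotC u v : dot u v = dot v u.
Proof. by apply: eq_bigr => i _; rewrite mulrC. Qed.

Lemma dotDl u v x : dot (u + v) x = dot u x + dot v x.
Proof. by rewrite -big_split; apply: eq_bigr => i _; rewrite mxE mulrDl. Qed.

Lemma dotZl (a : R) u v : dot (a *: u) v = a * dot u v.
Proof. by rewrite mulr_sumr; apply: eq_bigr => i _; rewrite mxE mulrA. Qed.

Lemma dotDr u v x : dot x (u + v) = dot x u + dot x v.
Proof. by rewrite dotC dotDl dotC [dot v x]dotC. Qed.

Lemma dotZr (a : R) u v : dot u (a *: v) = a * dot u v.
Proof. by rewrite dotC dotZl dotC. Qed.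

Lemma dot0l u : dot 0 u = 0.
Proof. by rewrite -(scale0r (0 : 'cV_k)) dotZl mul0r. Qed.

Lemma dot0r u : dot u 0 = 0. Proof. by rewrite dotC dot0l. Qed.

Lemma dotNl u v : dot (- u) v = - dot u v.
Proof. by rewrite -scaleN1r dotZl mulN1r. Qed.

Lemma dotNr u v : dot u (- v) = - dot u v.
Proof. by rewrite dotC dotNl dotC. Qed.

Lemma dotBl u v x : dot (u - v) x = dot u x - dot v x.
Proof. by rewrite dotDl dotNl. Qed.

Lemma dotBr u v x : dot x (u - v) = dot x u - dot x v.
Proof. by rewrite dotDr dotNr. Qed.

Lemma dot_sqrB u v :
  dot (u - v) (u - v) = dot u u - 2 * dot u v + dot v v.
Proof. by rewrite !(dotBl, dotBr) (dotC v u); ring. Qed.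

Lemma dot_suml (I : Type) (r : seq I) (p : pred I) (F : I -> 'cV[R]_k) u :
  dot (\sum_(i <- r | p i) F i) u = \sum_(i <- r | p i) dot (F i) u.
Proof.
by apply: (big_morph (fun v => dot v u)) => [v x|]; [exact: dotDl|exact: dot0l].
Qed.

Lemma dot_sumr (I : Type) (r : seq I) (p : pred I) (F : I -> 'cV[R]_k) u :
  dot u (\sum_(i <- r | p i) F i) = \sum_(i <- r | p i) dot u (F i).
Proof. by rewrite dotC dot_suml; apply: eq_bigr => i _; rewrite dotC. Qed.

Lemma dot_ge0 u : 0 <= dot u u.
Proof. by apply: sumr_ge0 => i _; exact: sqr_ge0. Qed.

Lemma dot_eq0 u : dot u u = 0 -> u = 0.
Proof.
move=> /eqP; rewrite psumr_eq0; last by move=> i _; exact: sqr_ge0.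
move=> /allP u0; apply/colP => i; rewrite mxE.
by have := u0 i (mem_index_enum i); rewrite /= mulf_eq0 orbb => /eqP.
Qed.

Lemma dot_gt0 u : u != 0 -> 0 < dot u u.
Proof.
by move=> u0; rewrite lt0r dot_ge0 andbT; apply: contra_neq u0 => /dot_eq0.
Qed.

Lemma l2norm_sqr u : l2norm u ^+ 2 = dot u u.
Proof.
rewrite sqr_sqrtr; last by apply: sumr_ge0 => i _; exact: sqr_ge0.
by apply: eq_bigr => i _; rewrite expr2.
Qed.

(** The Gaussian law of a linear form is obtained below by adding one
    coordinate at a time to a first one that has coefficient 1; every nonzero
    form is a multiple of such a form. *)
Lemma scale_unit_coord (theta : 'cV[R]_k) : theta != 0 ->
  exists a theta' i0, [/\ a != 0, theta = a *: theta' & theta' i0 0 = 1].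
Proof.
move=> th0; have /existsP[i0 ti0] : [exists i, theta i 0 != 0].
  apply: contra_neqT th0 => /existsPn th; apply/colP => i; rewrite mxE.
  by have := th i; rewrite negbK => /eqP.
exists (theta i0 0), ((theta i0 0)^-1 *: theta), i0; split => //.
  by rewrite scalerA divff// scale1r.
by rewrite mxE mulVf.
Qed.

End dot_theory.

(** * Orthonormal families and orthogonal projections *)

(** The recursion matches the inductions over families, in which one vector is
    split off at a time. *)
Fixpoint orthonormal_seq (R : realType) (k : nat) (us : seq 'cV[R]_k) : Prop :=
  if us is u :: vs then
    [/\ dot u u = 1, (forall v, v \in vs -> dot v u = 0) & orthonormal_seq vs]
  else True.

Definition supported_on (R : realType) (m : nat) (L : {set 'I_m}) (x : 'cV[R]_m) :=
  forall i, i \notin L -> x i 0 = 0.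

Definition proj_span (R : realType) (n : nat) (us : seq 'cV[R]_n) (v : 'cV[R]_n) :=
  \sum_(u <- us) dot u v *: u.

Section orthonormal_theory.
Context (R : realType) (n : nat).
Implicit Types (us : seq 'cV[R]_n) (u v x : 'cV[R]_n).

Lemma orthonormal_seq_coord us (f : 'cV[R]_n -> R) v : orthonormal_seq us ->
  v \in us -> dot v (\sum_(u <- us) f u *: u) = f v.
Proof.
elim: us => [//|u us IH] /= [u1 uo ous]; rewrite inE big_cons dotDr dotZr.
have [-> _|vu /= vus] := eqVneq v u; last by rewrite uo// mulr0 add0r IH.
rewrite u1 mulr1 dot_sumr big1_seq ?addr0// => x /andP[_ xus].
by rewrite dotZr dotC uo// mulr0.
Qed.

Lemma dot_proj_spanC us v x : dot v (proj_span us x) = dot (proj_span us v) x.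
Proof.
rewrite dot_sumr dot_suml; apply: eq_bigr => u _.
by rewrite dotZl dotZr mulrC (dotC v) mulrC.
Qed.

Lemma dot_proj_span us v : orthonormal_seq us ->
  dot (proj_span us v) (proj_span us v) = \sum_(u <- us) dot u v ^+ 2.
Proof.
move=> ous; rewrite {1}/proj_span dot_suml !big_seq; apply: eq_bigr => u uus.
by rewrite dotZl orthonormal_seq_coord// expr2.
Qed.

Lemma proj_span_id us x : orthonormal_seq us ->
  proj_span us (proj_span us x) = proj_span us x.
Proof.
move=> ous; rewrite [LHS]big_seq [RHS]big_seq; apply: eq_bigr => v vus.
by congr (_ *: _); exact: orthonormal_seq_coord.
Qed.

Lemma proj_span_residual us v u : orthonormal_seq us -> u \in us ->
  dot u (v - proj_span us v) = 0.
Proof. by move=> ous uus; rewrite dotBr orthonormal_seq_coord// subrr. Qed.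

Lemma dot_residual_le us v : orthonormal_seq us ->
  dot (v - proj_span us v) (v - proj_span us v) <= dot v v.
Proof.
move=> ous; rewrite !(dotBl, dotBr) dot_proj_spanC.
rewrite -[X in _ - (_ - X)]dot_proj_spanC (dot_proj_spanC us v).
have -> : dot (proj_span us v) (proj_span us v) = dot (proj_span us v) v.
  rewrite dot_proj_span// dot_suml; apply: eq_bigr => u _.
  by rewrite dotZl expr2.
rewrite subrr subr0 gerBl dot_suml.
by apply: sumr_ge0 => u _; rewrite dotZl -expr2 sqr_ge0.
Qed.

End orthonormal_theory.

(** Gram-Schmidt, keeping track of the fact that the new vectors are
    combinations of the given columns: this is what turns a projection into
    an explicit coefficient vector. *)
Lemma gram_schmidt_columns (R : realType) (n m : nat) (A : 'M[R]_(n, m))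
    (l : seq 'I_m) :
  exists us : seq 'cV[R]_n,
    [/\ orthonormal_seq us, (size us <= size l)%N,
        forall u, u \in us -> exists2 c : 'cV[R]_m,
          (forall i, i \notin l -> c i 0 = 0) & u = A *m c &
        forall i, i \in l -> proj_span us (col i A) = col i A].
Proof.
elim: l => [|k l [us [ous sus cus pus]]]; first by exists [::].
have cus' u : u \in us -> exists2 c : 'cV[R]_m,
    (forall i, i \notin k :: l -> c i 0 = 0) & u = A *m c.
  move=> /cus[c cl ->]; exists c => // i.
  by rewrite inE negb_or => /andP[_]; exact: cl.
pose r := col k A - proj_span us (col k A).
have ror v : v \in us -> dot v r = 0 by exact: proj_span_residual.
have [r0|r0] := eqVneq r 0.
  exists us; split=> //; first exact: leqW.
  move=> i; rewrite inE => /predU1P[->|/pus//].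
  by apply/eqP; rewrite -subr_eq0 -oppr_eq0 opprB -/r r0.
have rr0 := dot_gt0 r0.
pose nr := Num.sqrt (dot r r).
have nr0 : 0 < nr by rewrite sqrtr_gt0.
have nr2 : nr * nr = dot r r by rewrite -expr2; exact: sqr_sqrtr (ltW rr0).
pose u0 := nr^-1 *: r.
have u0o v : v \in us -> dot v u0 = 0.
  by move=> /ror; rewrite dotZr => ->; rewrite mulr0.
have proj0 v : proj_span us v = v -> dot u0 v = 0.
  move=> <-; rewrite dot_sumr big1_seq// => x /andP[_ /u0o].
  by move=> h; rewrite dotZr (dotC u0) h mulr0.
exists (u0 :: us); split.
- split=> //; rewrite dotZl dotZr -nr2.
  by field; rewrite gt_eqF.
- by rewrite ltnS.
- move=> u; rewrite inE => /predU1P[->|]; last exact: cus'.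
  have [y yl yE] : exists2 y : 'cV[R]_m,
      (forall i, i \notin k :: l -> y i 0 = 0) & proj_span us (col k A) = A *m y.
    rewrite /proj_span; elim: (us) cus' => [|v vs IHv] cvs.
      by exists 0; [move=> i _; rewrite mxE|rewrite big_nil mulmx0].
    have [|y yl yE] := IHv.
      by move=> u' u'vs; apply: cvs; rewrite inE u'vs orbT.
    have [c cl cE] := cvs v (mem_head _ _).
    exists (dot v (col k A) *: c + y).
      by move=> i il; rewrite !mxE cl// yl// mulr0 addr0.
    by rewrite big_cons yE mulmxDr -scalemxAr -cE.
  exists (nr^-1 *: (delta_mx k 0 - y)).
    move=> i il; rewrite !mxE yl// subr0.
    by move: il; rewrite inE negb_or => /andP[/negbTE-> _]; rewrite mulr0.
  by rewrite -scalemxAr mulmxBr -yE -colE.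
- move=> i; rewrite /proj_span inE big_cons => /predU1P[->|il]; last first.
    by rewrite proj0 ?pus// scale0r add0r; exact: pus.
  rewrite -/(proj_span us _).
  have -> : dot u0 (col k A) = nr.
    have -> : col k A = r + proj_span us (col k A) by rewrite subrK.
    rewrite dotDr [X in _ + X]proj0 ?addr0; last exact: proj_span_id.
    by rewrite dotZl -nr2; field; rewrite gt_eqF.
  by rewrite scalerA divff ?gt_eqF// scale1r subrK.
Qed.

(** * Matrices with incoherent columns *)

Lemma mulmx_sum_cols (R : realType) (n m : nat) (A : 'M[R]_(n, m)) (x : 'cV[R]_m) :
  A *m x = \sum_(i < m) x i 0 *: col i A.
Proof.
apply/colP => k; rewrite mxE summxE; apply: eq_bigr => i _.
by rewrite !mxE mulrC.
Qed.

(** Cauchy-Schwarz, as the nonnegativity of the variance of the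
    |x_i| over L. *)
Lemma l1norm_sqr_le (R : realType) (m : nat) (L : {set 'I_m}) (x : 'cV[R]_m) :
  supported_on L x -> l1norm x ^+ 2 <= #|L|%:R * dot x x.
Proof.
move=> xL; set N := l1norm x; set s : R := #|L|%:R.
have NE : N = \sum_(i in L) `|x i 0|.
  rewrite /N /l1norm (bigID (mem L))/= [X in _ + X]big1 ?addr0// => i iL.
  by rewrite xL// normr0.
have DE : dot x x = \sum_(i in L) `|x i 0| ^+ 2.
  rewrite /dot (bigID (mem L))/= [X in _ + X]big1 ?addr0 => [|i iL].
    by apply: eq_bigr => i _; rewrite real_normK ?num_real// expr2.
  by rewrite xL// mulr0.
have sE : s = \sum_(i in L) 1 by rewrite sumr_const.
have [L0|L0] := posnP #|L|.
  rewrite NE big1; first by rewrite expr0n /= mulr_ge0 ?dot_ge0// ler0n.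
  by move=> i; rewrite (cards0_eq L0) inE.
have s0 : 0 < s by rewrite ltr0n.
have : 0 <= \sum_(i in L) (s * `|x i 0| - N) ^+ 2.
  by apply: sumr_ge0 => i _; exact: sqr_ge0.
have -> : \sum_(i in L) (s * `|x i 0| - N) ^+ 2 = s * (s * dot x x - N ^+ 2).
  transitivity (s ^+ 2 * dot x x - 2 * s * N * N + N ^+ 2 * s); last by ring.
  transitivity (\sum_(i in L) (s ^+ 2 * `|x i 0| ^+ 2 +
      (- (2 * s * N) * `|x i 0| + N ^+ 2 * 1))).
    by apply: eq_bigr => i _; ring.
  by rewrite !big_split/= -!mulr_sumr -DE -NE -sE; ring.
by rewrite pmulr_rge0// subr_ge0.
Qed.

Lemma mulmx_kernel (R : realType) (n m : nat) (A : 'M[R]_(n, m)) : (n < m)%N ->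
  exists2 x : 'cV[R]_m, x != 0 & A *m x = 0.
Proof.
move=> nm; have : kermx A^T != 0.
  rewrite kermx_eq0 /row_free mxrank_tr neq_ltn (leq_ltn_trans _ nm)//.
  exact: rank_leq_row.
rewrite -nz_row_eq0 => k0; exists (nz_row (kermx A^T))^T.
  by rewrite -trmx0 (inj_eq trmx_inj).
apply: trmx_inj; rewrite trmx_mul trmxK trmx0.
by apply/sub_kermxP; exact: nz_row_sub.
Qed.

Lemma dot_col_coherence (R : realType) (n m : nat) (A : 'M[R]_(n, m)) i j :
  i != j -> `|dot (col i A) (col j A)| <= mutual_coherence A.
Proof.
move=> ij; have -> : dot (col i A) (col j A) = ((col i A)^T *m col j A) 0 0.
  by rewrite mxE; apply: eq_bigr => k _; rewrite !mxE.
exact: (le_bigmax_cond (j := (i, j)) 0 (fun p : 'I_m * 'I_m =>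
  `|((col p.1 A)^T *m col p.2 A) 0 0|)) ij.
Qed.

Section incoherent_matrix.
Context (R : realType) (n m : nat) (A : 'M[R]_(n, m)) (mu : R).
Context (unit_cols : forall i, dot (col i A) (col i A) = 1)
  (coherence : forall i j, i != j -> `|dot (col i A) (col j A)| <= mu).

Lemma dot_mulmx (v : 'cV[R]_n) (x : 'cV[R]_m) :
  dot v (A *m x) = \sum_(i < m) x i 0 * dot v (col i A).
Proof.
by rewrite mulmx_sum_cols dot_sumr; apply: eq_bigr => i _; rewrite dotZr.
Qed.

Lemma dot_mulmx_supported (L : {set 'I_m}) (v : 'cV[R]_n) (x : 'cV[R]_m) :
  supported_on L x -> (forall i, i \in L -> dot v (col i A) = 0) ->
  dot v (A *m x) = 0.
Proof.
move=> xL vL; rewrite dot_mulmx big1// => i _.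
by have [/vL->|/xL->] := boolP (i \in L); rewrite ?mulr0 ?mul0r.
Qed.

(** Diagonal dominance of the Gram matrix: off-diagonal entries are at most
    mu, so the quadratic form is at least (1 + mu) |x|_2^2 - mu |x|_1^2. *)
Lemma gram_lower_bound (L : {set 'I_m}) (x : 'cV[R]_m) : 0 <= mu ->
  supported_on L x ->
  (1 + mu - #|L|%:R * mu) * dot x x <= dot (A *m x) (A *m x).
Proof.
move=> mu0 xL.
have : (1 + mu) * dot x x - mu * l1norm x ^+ 2 <= dot (A *m x) (A *m x).
  have -> : mu * l1norm x ^+ 2 =
      \sum_(i < m) \sum_(j < m) mu * (`|x i 0| * `|x j 0|).
    rewrite /l1norm expr2 mulr_suml mulr_sumr; apply: eq_bigr => i _.
    by rewrite !mulr_sumr.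
  rewrite dot_mulmx /dot mulr_sumr -sumrB; apply: ler_sum => i _.
  rewrite -/(dot (A *m x) (col i A)) dotC dot_mulmx.
  rewrite [X in _ - X](bigD1 i)//= [X in _ <= _ * X](bigD1 i)//= unit_cols.
  rewrite -normrM ger0_norm -?expr2 ?sqr_ge0// mulrDr.
  have -> : (1 + mu) * (x i 0 ^+ 2) - (mu * x i 0 ^+ 2 +
      \sum_(j < m | j != i) mu * (`|x i 0| * `|x j 0|)) =
    x i 0 * (x i 0 * 1) + - \sum_(j < m | j != i) mu * (`|x i 0| * `|x j 0|).
    by ring.
  rewrite lerD2l mulr_sumr -sumrN; apply: ler_sum => j ji.
  rewrite lerNl; apply: (le_trans (ler_norm _)).
  rewrite normrN !normrM mulrA mulrC.
  by rewrite ler_wpM2r ?mulr_ge0// coherence// eq_sym.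
apply: le_trans.
have := ler_wpM2l mu0 (l1norm_sqr_le xL).
set s : R := #|L|%:R; set N := l1norm x; set D := dot x x => h.
by lra.
Qed.

(** Here y holds the coefficients on L of the projection of A z, where z
    lives outside L. The correlations of A z with the columns in L are at most
    mu |z|_1, and the Gram matrix on L is diagonally dominant. When
    3 #|L| mu < 1, this forces |y|_1 < |z|_1 / 2 for z != 0: the exact recovery
    condition. *)
Lemma l1norm_projection_coeff (L : {set 'I_m}) (us : seq 'cV[R]_n)
    (y z : 'cV[R]_m) :
  orthonormal_seq us -> 0 <= mu ->
  (forall i, i \in L -> proj_span us (col i A) = col i A) ->
  supported_on L y -> supported_on (~: L) z ->
  A *m y = proj_span us (A *m z) ->
  (1 + mu - #|L|%:R * mu) * l1norm y <= #|L|%:R * mu * l1norm z.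
Proof.
move=> ous mu0 pus yL zL Ay.
have yE : l1norm y = \sum_(i in L) `|y i 0|.
  rewrite /l1norm (bigID (mem L))/= [X in _ + X]big1 ?addr0// => i iL.
  by rewrite yL// normr0.
have key i : i \in L -> `|y i 0| <= mu * l1norm z + mu * (l1norm y - `|y i 0|).
  move=> iL.
  have yi : y i 0 = dot (col i A) (A *m z) -
      \sum_(j < m | j != i) y j 0 * dot (col i A) (col j A).
    have := dot_mulmx (col i A) y.
    rewrite Ay dot_proj_spanC pus// => ->.
    by rewrite (bigD1 i)//= unit_cols; ring.
  rewrite {1}yi; apply: (le_trans (ler_normB _ _)); apply: lerD.
    rewrite dot_mulmx; apply: (le_trans (ler_norm_sum _ _ _)).
    rewrite /l1norm mulr_sumr; apply: ler_sum => j _; rewrite normrM mulrC.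
    have [ji|ji] := eqVneq i j; last by rewrite ler_wpM2r// coherence.
    by rewrite -ji zL ?inE ?negbK// normr0 !mulr0.
  apply: (le_trans (ler_norm_sum _ _ _)).
  have -> : l1norm y - `|y i 0| = \sum_(j < m | j != i) `|y j 0|.
    by rewrite /l1norm (bigD1 i)//= addrAC subrr add0r.
  rewrite mulr_sumr.
  apply: ler_sum => j ji; rewrite normrM mulrC ler_wpM2r// coherence//.
  by rewrite eq_sym.
have : l1norm y <= \sum_(i in L) (mu * l1norm z + mu * l1norm y + (- mu) * `|y i 0|).
  rewrite {1}yE; apply: ler_sum => i /key h; apply: (le_trans h).
  by rewrite le_eqVlt; apply/orP; left; apply/eqP; ring.
rewrite big_split/= sumr_const -mulr_sumr -yE -[X in _ <= X + _]mulr_natl => h.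
set s : R := #|L|%:R in h *.
by lra.
Qed.

(** As n < m, the matrix has a kernel vector; but any fewer than
    1 + 1 / mu columns of unit length and coherence mu are independent. *)
Lemma coherence_sparsity_dim (s : nat) :
  0 <= mu -> (n < m)%N -> 3 * s%:R * mu < 1 -> (3 * s + 1 < m)%N.
Proof.
move=> mu0 nm small; rewrite ltnNge; apply/negP => ms.
have [x x0 Ax] := mulmx_kernel A nm.
have xs : supported_on [set: 'I_m] x by move=> i; rewrite inE.
have := gram_lower_bound mu0 xs; rewrite Ax dot0l cardsT card_ord => h.
have := dot_gt0 x0 => D0.
have : m%:R <= 3 * s%:R + 1 :> R by rewrite -natrM natr1 ler_nat -addn1.
move=> hm; have hm' := ler_wpM2r mu0 hm.
have k0 : 0 < 1 + mu - m%:R * mu by lra.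
by have := mulr_gt0 k0 D0; lra.
Qed.

End incoherent_matrix.

(** * Minimizers of the basis pursuit denoising objective *)

Section l1norm_theory.
Context (R : realType) (m : nat).
Implicit Types x y : 'cV[R]_m.

Lemma l1norm_ge0 x : 0 <= l1norm x.
Proof. exact: sumr_ge0. Qed.

Lemma ler_l1normD x y : l1norm (x + y) <= l1norm x + l1norm y.
Proof.
by rewrite -big_split; apply: ler_sum => i _; rewrite mxE ler_normD.
Qed.

Lemma l1norm_eq0 x : l1norm x = 0 -> x = 0.
Proof.
move=> /eqP; rewrite psumr_eq0// => /allP x0; apply/colP => i; rewrite mxE.
by have := x0 i (mem_index_enum i); rewrite /= normr_eq0 => /eqP.
Qed.

End l1norm_theory.

Lemma bpdn_objectiveE (R : realType) (n m : nat) (A : 'M[R]_(n, m)) b gamma x :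
  bpdn_objective A b gamma x =
  2^-1 * dot (b - A *m x) (b - A *m x) + gamma * l1norm x.
Proof. by rewrite /bpdn_objective l2norm_sqr. Qed.

Section bpdn.
Context (R : realType) (n m : nat) (A : 'M[R]_(n, m)) (mu : R).
Context (unit_cols : forall i, dot (col i A) (col i A) = 1).
Context (coherence : forall i j, i != j -> `|dot (col i A) (col j A)| <= mu).
Context (mu0 : 0 <= mu).
Context (b : 'cV[R]_n) (gamma : R) (xh : 'cV[R]_m).
Context (gamma0 : 0 < gamma).
Context (xh_min : is_bpdn_solution A b gamma xh).

(** Stationarity of the minimizer in the direction of the i-th coordinate.
    If the correlation c exceeded gamma in absolute value, moving by
    c - gamma (or c + gamma) would decrease the objective. *)
Lemma bpdn_solution_residual i : `|dot (col i A) (b - A *m xh)| <= gamma.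
Proof.
have [r rE] : exists r, r = b - A *m xh by exists (b - A *m xh).
rewrite -rE; set c := dot (col i A) r.
have step t : t * c <= t ^+ 2 / 2 + gamma * `|t|.
  have := xh_min (xh + t *: delta_mx i 0); rewrite !bpdn_objectiveE.
  have -> : b - A *m (xh + t *: delta_mx i 0) = r - t *: col i A.
    by rewrite mulmxDr -scalemxAr -colE opprD addrA rE.
  rewrite -rE dot_sqrB !dotZr dotZl unit_cols (dotC r) -/c.
  have lt : l1norm (t *: delta_mx i 0 : 'cV[R]_m) = `|t|.
    rewrite /l1norm (bigD1 i)//= big1 => [|j /negbTE ji].
      by rewrite !mxE !eqxx mulr1 addr0.
    by rewrite !mxE ji mulr0 normr0.
  have := ler_l1normD xh (t *: delta_mx i 0); rewrite lt => h1 h2.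
  have h3 : gamma * l1norm (xh + t *: delta_mx i 0) <= gamma * (l1norm xh + `|t|).
    by rewrite ler_wpM2l// ltW.
  by lra.
rewrite ler_norml; apply/andP; split; rewrite leNgt; apply/negP => h.
  have t0 : c + gamma < 0 by lra.
  have := step (c + gamma); rewrite ltr0_norm// => h1.
  have : 0 < (c + gamma) ^+ 2 by rewrite exprn_even_gt0//= lt_eqF.
  by lra.
have t0 : 0 < c - gamma by lra.
have := step (c - gamma); rewrite gtr0_norm// => h1.
have : 0 < (c - gamma) ^+ 2 by rewrite exprn_gt0.
by lra.
Qed.

Context (L : {set 'I_m}) (us : seq 'cV[R]_n) (x0 : 'cV[R]_m) (W : 'cV[R]_n).
Context (ous : orthonormal_seq us).
Context (us_cols : forall u, u \in us ->
  exists2 c : 'cV[R]_m, supported_on L c & u = A *m c).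
Context (proj_cols : forall i, i \in L -> proj_span us (col i A) = col i A).
Context (small_support : 3 * #|L|%:R * mu < 1).
Context (x0L : supported_on L x0).
Context (bE : b = A *m x0 + W).

Lemma proj_span_coeff v : exists2 y : 'cV[R]_m,
  supported_on L y & proj_span us v = A *m y.
Proof.
rewrite /proj_span; elim: us us_cols => [|u vs IH] cvs.
  by exists 0; [move=> i _; rewrite mxE|rewrite big_nil mulmx0].
have [|y yl yE] := IH; first by move=> u' u'vs; apply: cvs; rewrite inE u'vs orbT.
have [c cl cE] := cvs u (mem_head _ _).
exists (dot u v *: c + y).
  by move=> i il; rewrite !mxE cl// yl// mulr0 addr0.
by rewrite big_cons yE mulmxDr -scalemxAr -cE.
Qed.

Lemma residual_orthogonal i v : i \in L -> dot (v - proj_span us v) (col i A) = 0.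
Proof.
by move=> iL; rewrite dotC dotBr dot_proj_spanC proj_cols// subrr.
Qed.

Context (noise_small : forall i, i \notin L ->
  `|dot (col i A - proj_span us (col i A)) W| <= gamma / 2).

(** The competitor replaces the part z of the minimizer outside L by
    coefficients y on L with A y equal to the projection of A z. This leaves
    the projected residual unchanged and saves at least
    gamma (|z|_1 - |y|_1), which outweighs what the noise can gain through z. *)
Lemma bpdn_solution_supported : supported_on L xh.
Proof.
pose z : 'cV[R]_m := \col_i (if i \in L then 0 else xh i 0).
pose p := xh - z.
have zL : supported_on (~: L) z by move=> i; rewrite !inE negbK mxE => ->.
have pL : supported_on L p by move=> i /negbTE iL; rewrite !mxE iL subrr.
have [y yL yE] := proj_span_coeff (A *m z).
pose rho := A *m z - proj_span us (A *m z).
pose e := b - A *m (p + y).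
have xhE : b - A *m xh = e - rho.
  rewrite /e /rho yE -[in LHS](subrK z xh) -/p !mulmxDr.
  by rewrite !opprD opprK !addrA; apply/colP => i; rewrite !mxE; ring.
have split_norm : l1norm xh = l1norm p + l1norm z.
  rewrite /l1norm -big_split; apply: eq_bigr => i _; rewrite !mxE.
  by case: ifP => _ /=; rewrite ?subr0 ?subrr normr0 ?addr0 ?add0r.
have ny : (1 + mu - #|L|%:R * mu) * l1norm y <= #|L|%:R * mu * l1norm z.
  by apply: (l1norm_projection_coeff unit_cols coherence ous) => //; rewrite yE.
have erho : dot e rho <= gamma / 2 * l1norm z.
  have rhoL q : supported_on L q -> dot rho (A *m q) = 0.
    by move=> /dot_mulmx_supported; apply=> i iL; exact: residual_orthogonal.
  have -> : dot e rho = \sum_(i < m) z i 0 * dot (col i A - proj_span us (col i A)) W.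
    rewrite dotC /e bE addrAC -mulmxBr dotDr rhoL ?add0r; last first.
      move=> i iL; rewrite [LHS]mxE [X in _ + X]mxE [X in - X]mxE.
      by rewrite x0L// pL// yL// addr0 subrr.
    rewrite /rho dotBl -dot_proj_spanC -dotBr !mulmx_sum_cols dot_suml.
    by apply: eq_bigr => i _; rewrite dotZl dotBr dot_proj_spanC -dotBl.
  rewrite /l1norm mulr_sumr; apply: ler_sum => i _.
  have [iL|iL] := boolP (i \in L).
    by rewrite zL ?inE ?negbK// mul0r normr0 mulr0.
  apply: (le_trans (ler_norm _)); rewrite normrM mulrC.
  by rewrite ler_wpM2r// noise_small.
have := xh_min (p + y); rewrite !bpdn_objectiveE xhE -/e dot_sqrB split_norm => hmin.
have := ler_l1normD p y => hpy.
have hpy' := ler_wpM2l (ltW gamma0) hpy.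
have rho0 := dot_ge0 rho.
have N0 := l1norm_ge0 z.
have sparse := small_support; have mu_ge0 := mu0.
set s : R := #|L|%:R in ny sparse.
set Z := l1norm z in N0 ny erho hmin; set Y := l1norm y in ny hpy hpy'.
(* Minimality: what the competitor saves cannot exceed what the noise gains. *)
have YZ : gamma * (Z / 2) <= gamma * Y.
  have : gamma * l1norm (p + y) <= gamma * (l1norm p + Y) by exact: hpy'.
  by move=> ?; lra.
rewrite ler_pM2l// in YZ.
have Z0 : Z = 0.
  have s0 : 0 <= s by rewrite ler0n.
  apply/eqP; rewrite eq_le N0 andbT leNgt; apply/negP => Zpos.
  have k0 : 0 < 1 + mu - s * mu.
    have : 0 <= s * mu by exact: mulr_ge0.
    by lra.
  have := ler_wpM2l (ltW k0) YZ => h.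
  have : 0 < (1 + mu - 3 * s * mu) * Z by rewrite mulr_gt0//; lra.
  by lra.
move=> i iL; have /(congr1 (fun v : 'cV[R]_m => v i 0)) := l1norm_eq0 Z0.
by rewrite !mxE (negbTE iL).
Qed.

Context (V : R).
Context (proj_noise : dot (proj_span us W) (proj_span us W) <= 2 * V * #|L|%:R).
Context (V0 : 0 < V).

(** With v the coefficients of the projected noise, x0 + v is the least
    squares estimate on L; h is the difference between it and
    the minimizer. Both h
    and v are controlled by [gram_lower_bound], whose constant is at least
    2 / 3. *)
Lemma bpdn_solution_error :
  dot (x0 - xh) (x0 - xh) <= (Num.sqrt (3 * V) + 3 / 2 * gamma) ^+ 2 * #|L|%:R.
Proof.
have [v vL vE] := proj_span_coeff W.
pose h := xh - x0 - v.
have xhL := bpdn_solution_supported.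
have sparse := small_support; have mu_ge0 := mu0.
have g_gt0 := gamma0; have V_gt0 := V0; have pn := proj_noise.
have hL : supported_on L h by move=> i iL; rewrite !mxE xhL// x0L// vL// !subr0.
have kap : 2 / 3 <= 1 + mu - #|L|%:R * mu by lra.
have AhE i : i \in L -> dot (col i A) (A *m h) = - dot (col i A) (b - A *m xh).
  move=> iL; rewrite /h !mulmxBr -vE bE.
  have := residual_orthogonal W iL; rewrite dotC dotBr => /eqP.
  rewrite subr_eq0 => /eqP WE.
  rewrite !(dotDr, dotNr) -WE; ring.
set s : R := #|L|%:R in kap *.
have Ah : dot (A *m h) (A *m h) <= gamma * l1norm h.
  rewrite dot_mulmx /l1norm mulr_sumr; apply: ler_sum => i _.
  have [iL|iL] := boolP (i \in L); last by rewrite hL// mul0r normr0 mulr0.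
  apply: (le_trans (ler_norm _)); rewrite normrM mulrC ler_wpM2r//.
  by rewrite dotC AhE// normrN bpdn_solution_residual.
have h1 := gram_lower_bound unit_cols coherence mu0 hL.
have h2 := l1norm_sqr_le hL.
have v1 := gram_lower_bound unit_cols coherence mu0 vL.
rewrite -vE in v1.
rewrite -/s in h1 h2 v1 pn.
have D0 := dot_ge0 h; have E0 := dot_ge0 v; have N0 := l1norm_ge0 h.
set D := dot h h in h1 h2 D0 *; set E := dot v v in v1 E0 *.
set N := l1norm h in Ah h2 N0 *.
have h3 : 2 / 3 * D <= gamma * N.
  by have := ler_wpM2r D0 kap; lra.
have s0 : 0 <= s by rewrite ler0n.
pose Q := 3 / 2 * gamma; pose p := Num.sqrt (3 * V).
have Q0 : 0 < Q by rewrite /Q; lra.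
have p0 : 0 < p by rewrite sqrtr_gt0; lra.
have p2 : p ^+ 2 = 3 * V by rewrite sqr_sqrtr//; lra.
have DQ : D <= Q ^+ 2 * s.
  have DN : D <= Q * N by rewrite /Q; lra.
  have [->|Dn0] := eqVneq D 0; first by rewrite mulr_ge0// sqr_ge0.
  have Dpos : 0 < D by rewrite lt0r Dn0.
  rewrite -(ler_pM2r Dpos).
  have : D * D <= (Q * N) * (Q * N) by exact: ler_pM.
  have := ler_wpM2l (sqr_ge0 Q) h2.
  by lra.
have EV : E <= p ^+ 2 * s.
  by have := ler_wpM2r E0 kap; rewrite p2; lra.
(* The weights p and Q make the two squares D and E contribute equally. *)
have cross : 2 * dot h v <= 2 * p * Q * s.
  have : 0 <= dot (p *: h - Q *: v) (p *: h - Q *: v) by exact: dot_ge0.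
  rewrite dot_sqrB !dotZl !dotZr -/D -/E => k.
  have k1 := ler_wpM2l (sqr_ge0 p) DQ.
  have k2 := ler_wpM2l (sqr_ge0 Q) EV.
  rewrite -(ler_pM2l (mulr_gt0 p0 Q0)).
  by lra.
have -> : x0 - xh = - (h + v) by rewrite /h subrK opprB.
rewrite dotNl dotNr opprK (dotDl h v) !(dotDr h v) (dotC v h) -/D -/E -/p -/Q.
by lra.
Qed.
End bpdn.

(** * Centered Gaussian measures on the line *)

Lemma ge0_integral_normal_prob (R : realType) (m s : R) (f : R -> \bar R) :
  measurable_fun [set: R] f -> (forall x, 0 <= f x)%E ->
  (\int[normal_prob m s]_x f x =
   \int[lebesgue_measure]_x (f x * (normal_pdf m s x)%:E))%E.
Proof.
move=> mf f0.
have dom := normal_prob_dominates m s.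
rewrite -(Radon_Nikodym_SigmaFinite.change_of_variables dom f0 measurableT mf).
have ih := Radon_Nikodym_SigmaFinite.f_integrable dom.
apply: ae_eq_integral => //.
- by apply: emeasurable_funM => //; exact: measurable_int ih.
- apply: emeasurable_funM => //; apply/measurable_EFinP.
  exact: measurable_normal_pdf.
- apply: ae_eqe_mul2l; apply: integral_ae_eq => //.
  + by apply/measurable_EFinP; exact: measurable_normal_pdf.
  + move=> E _ mE; rewrite -Radon_Nikodym_SigmaFinite.f_integral//.
Qed.

Lemma lebesgue_measure_shift (R : realType) (a : R) (A : set R) :
  measurable A ->
  pushforward lebesgue_measure (fun x : R => x + a : measurableTypeR R) A =
  lebesgue_measure A.
Proof.
move=> mA; apply/esym/lebesgue_measure_unique => //=.
  exact: measurable_funD.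
move=> mS _ [[x y]] _ <-.
rewrite /pushforward.
rewrite (_ : _ @^-1` _ = `]x - a, y - a]%classic).
  rewrite !lebesgue_measure_itv/= !lte_fin ltrD2r; case: ifP => // _.
  by congr (_%:E); ring.
by apply/seteqP; split=> z /=; rewrite !in_itv/= ltrBlDr lerBrDr.
Qed.

Lemma ge0_integral_shift (R : realType) (a : R) (f : R -> \bar R) :
  measurable_fun [set: R] f -> (forall x, 0 <= f x)%E ->
  (\int[lebesgue_measure]_x f (x + a)%R = \int[lebesgue_measure]_x f x)%E.
Proof.
move=> mf f0.
have mS : @measurable_fun _ _ (measurableTypeR R) (measurableTypeR R)
    setT (fun x => x + a) by exact: measurable_funD.
rewrite -[LHS](ge0_integral_pushforward mS lebesgue_measure measurableT mf)//.
by apply: eq_measure_integral => //= A mA _; exact: lebesgue_measure_shift.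
Qed.

Lemma normal_pdf_explicit (R : realType) (m s x : R) : 0 < s ->
  normal_pdf m s x =
  s^-1 * (Num.sqrt (pi *+ 2))^-1 * expR (- (x - m) ^+ 2 / (s ^+ 2 *+ 2)).
Proof.
move=> s0; rewrite normal_pdfE ?gt_eqF// /normal_fun /normal_peak.
by rewrite -mulrnAr sqrtrM ?sqr_ge0// sqrtr_sqr gtr0_norm// invfM.
Qed.

(** Completing the square turns the integrand into a multiple of another
    normal density. *)
Lemma integral_expR_quadratic_normal_pdf (R : realType) (s a beta : R) :
  0 < s -> 0 < 1 - 2 * a * s ^+ 2 ->
  (\int[lebesgue_measure]_x
     (expR (beta * x + a * x ^+ 2) * normal_pdf 0 s x)%:E)%E =
  ((Num.sqrt (1 - 2 * a * s ^+ 2))^-1 *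
   expR (beta ^+ 2 * s ^+ 2 / (2 * (1 - 2 * a * s ^+ 2))))%:E.
Proof.
move=> s0 D0; set D := 1 - _ in D0 *; set K := _ * expR (_ / _).
have qD0 : 0 < Num.sqrt D by rewrite sqrtr_gt0.
have s'0 : 0 < s / Num.sqrt D by rewrite divr_gt0.
have K0 : 0 <= K by rewrite mulr_ge0// ?invr_ge0 ?ltW// expR_gt0.
transitivity (\int[lebesgue_measure]_x
    (K%:E * (normal_pdf (beta * s ^+ 2 / D) (s / Num.sqrt D) x)%:E)%E)%E.
  apply: eq_integral => x _; rewrite -EFinM; congr (_%:E).
  rewrite !normal_pdf_explicit// /K; set c := (Num.sqrt (pi *+ 2))^-1.
  transitivity (s^-1 * c *
      (expR (beta * x + a * x ^+ 2) * expR (- (x - 0) ^+ 2 / (s ^+ 2 *+ 2)))).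
    by rewrite mulrCA.
  set E1 := expR (beta ^+ 2 * s ^+ 2 / (2 * D)).
  set E2 := expR (- (x - beta * _ / _) ^+ 2 / _).
  transitivity (s^-1 * c * (E1 * E2)); last first.
    by rewrite invfM invrK; field; rewrite !gt_eqF.
  congr (_ * _); rewrite -!expRD; congr expR.
  rewrite exprMn exprVn sqr_sqrtr ?ltW// subr0.
  have -> : a = (1 - D) / (2 * s ^+ 2) by rewrite /D; field; rewrite gt_eqF.
  by field; rewrite !gt_eqF.
rewrite ge0_integralZl//.
- by rewrite integral_normal_pdf mule1.
- by apply/measurable_EFinP; exact: measurable_normal_pdf.
- by move=> x _; rewrite lee_fin normal_pdf_ge0.
Qed.

Lemma integral_normal_pdf_convolution (R : realType) (s1 s2 c z : R) :
  0 < s1 -> 0 < s2 ->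
  (\int[lebesgue_measure]_y
     (normal_pdf 0 s1 (z - c * y) * normal_pdf 0 s2 y)%:E)%E =
  (normal_pdf 0 (Num.sqrt (s1 ^+ 2 + c ^+ 2 * s2 ^+ 2)) z)%:E.
Proof.
move=> s10 s20.
set V := s1 ^+ 2 + c ^+ 2 * s2 ^+ 2.
have V0 : 0 < V by rewrite ltr_wpDr ?exprn_gt0// mulr_ge0// sqr_ge0.
have S0 : 0 < Num.sqrt V by rewrite sqrtr_gt0.
have DE : 1 - 2 * (- c ^+ 2 / (2 * s1 ^+ 2)) * s2 ^+ 2 = V / s1 ^+ 2.
  by rewrite /V; field; rewrite gt_eqF.
have D0 : 0 < 1 - 2 * (- c ^+ 2 / (2 * s1 ^+ 2)) * s2 ^+ 2.
  by rewrite DE divr_gt0// exprn_gt0.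
transitivity (\int[lebesgue_measure]_y ((normal_pdf 0 s1 z)%:E *
   (expR (z * c / s1 ^+ 2 * y + - c ^+ 2 / (2 * s1 ^+ 2) * y ^+ 2) *
      normal_pdf 0 s2 y)%:E)%E)%E.
  apply: eq_integral => y _; rewrite -EFinM; congr (_%:E).
  rewrite mulrA; congr (_ * _); rewrite !normal_pdf_explicit// -[RHS]mulrA -expRD.
  by congr (_ * expR _); field; rewrite gt_eqF.
rewrite ge0_integralZl//; first last.
- by rewrite lee_fin normal_pdf_ge0.
- by move=> y _; rewrite lee_fin mulr_ge0 ?expR_ge0 ?normal_pdf_ge0.
- apply/measurable_EFinP; apply: measurable_funM; last exact: measurable_normal_pdf.
  apply: measurableT_comp => //; apply: measurable_funD.
    exact: measurable_funM.
  by apply: measurable_funM => //; exact: measurable_funX.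
rewrite integral_expR_quadratic_normal_pdf// DE -EFinM; congr (_%:E).
rewrite !normal_pdf_explicit// sqrtrM ?ltW// sqrtrV ?exprn_ge0 ?ltW//.
rewrite sqrtr_sqr gtr0_norm// invfM invrK !subr0 sqr_sqrtr ?ltW//.
set C := (Num.sqrt (pi *+ 2))^-1; set q := Num.sqrt V.
set E1 := expR _; set E2 := expR _.
transitivity (q^-1 * C * (E1 * E2)); first by field; rewrite !gt_eqF.
rewrite -expRD; congr (_ * expR _).
rewrite /V; field; rewrite exprMn -/V.
by rewrite !gt_eqF.
Qed.

(** Fubini and translation invariance of Lebesgue measure reduce the claim to
    the convolution of the densities. *)
Lemma normal_prob_convolution (R : realType) (s1 s2 c : R) (C : set R) :
  0 < s1 -> 0 < s2 -> measurable C ->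
  (normal_prob 0 s1 \x normal_prob 0 s2)%E [set p : R * R | C (p.1 + c * p.2)]
  = normal_prob 0 (Num.sqrt (s1 ^+ 2 + c ^+ 2 * s2 ^+ 2)) C.
Proof.
move=> s10 s20 mC.
set N1 := normal_prob 0 s1; set N2 := normal_prob 0 s2.
have mf : measurable_fun [set: measurableTypeR R * measurableTypeR R]
    (fun p : measurableTypeR R * measurableTypeR R => p.1 + c * p.2 : R).
  apply: measurable_funD; first exact: measurable_fst.
  by apply: measurable_funM => //; exact: measurable_snd.
set A := [set p : R * R | _].
have mA : @measurable _ (measurableTypeR R * measurableTypeR R)%type A.
  by rewrite -[A]setTI; exact: mf.
have mI : measurable_fun [set: R] (\1_C : R -> R) by exact: measurable_indic.
rewrite -[A]setIT.
rewrite -(@integral_indic _ _ _ (N1 \x N2)%E setT measurableT A mA).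
have mIA : measurable_fun [set: measurableTypeR R * measurableTypeR R]
   (fun p => (\1_A p)%:E : \bar R).
  by apply/measurable_EFinP; exact: measurable_indic.
rewrite fubini_tonelli2//=.
transitivity (\int[N2]_y \int[lebesgue_measure]_z
       (\1_C z * normal_pdf 0 s1 (z - c * y))%:E)%E.
  apply: eq_integral => y _; rewrite /fubini_G ge0_integral_normal_prob; last 2 first.
  - exact: measurable_fun_pair1 mIA.
  - by move=> x; rewrite lee_fin indicE.
  rewrite -[RHS](@ge0_integral_shift _ (c * y)).
  - apply: eq_integral => x _; rewrite -EFinM addrK; congr (_%:E).
  - apply/measurable_EFinP; apply: measurable_funM => //.
    apply: measurableT_comp; first exact: measurable_normal_pdf.
    exact: measurable_funB.
  - by move=> x; rewrite lee_fin mulr_ge0// ?indicE// normal_pdf_ge0.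
have mK : measurable_fun [set: measurableTypeR R * measurableTypeR R]
   (fun p => (\1_C p.1 * normal_pdf 0 s1 (p.1 - c * p.2))%:E : \bar R).
  apply/measurable_EFinP; apply: measurable_funM.
    exact: measurableT_comp.
  apply: measurableT_comp; first exact: measurable_normal_pdf.
  by apply: measurable_funB => //; exact: measurable_funM.
rewrite -(@fubini_tonelli _ _ _ _ _ lebesgue_measure N2 _ mK); last first.
  by move=> x; rewrite lee_fin mulr_ge0// ?indicE// normal_pdf_ge0.
rewrite [in RHS]/normal_prob [in RHS]integral_mkcond; apply: eq_integral => z _.
rewrite ge0_integral_normal_prob; last 2 first.
- exact: measurable_fun_pair2 mK.
- by move=> x; rewrite lee_fin mulr_ge0// ?indicE// normal_pdf_ge0.
transitivity (\int[lebesgue_measure]_y ((\1_C z)%:E *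
   (normal_pdf 0 s1 (z - c * y) * normal_pdf 0 s2 y)%:E))%E.
  by apply: eq_integral => y _; rewrite -!EFinM mulrA.
rewrite ge0_integralZl//; last first.
- by move=> y _; rewrite lee_fin mulr_ge0 ?normal_pdf_ge0.
- apply/measurable_EFinP; apply: measurable_funM; last exact: measurable_normal_pdf.
  apply: measurableT_comp; first exact: measurable_normal_pdf.
  by apply: measurable_funB => //; exact: measurable_funM.
rewrite integral_normal_pdf_convolution// patchE indicE.
by case: ifP; rewrite ?mul1e ?mul0e.
Qed.

Lemma normal_probN (R : realType) (s : R) (C : set R) : measurable C ->
  0 < s -> normal_prob 0 s [set x | C (- x)] = normal_prob 0 s C.
Proof.
move=> mC s0; rewrite /normal_prob.
have mN : @measurable_fun _ _ (measurableTypeR R) (measurableTypeR R) setT -%R.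
  by [].
have pdfN x : normal_pdf 0 s (- x) = normal_pdf 0 s x.
  by rewrite !normal_pdf_explicit// !subr0 sqrrN.
transitivity (\int[pushforward lebesgue_measure
    (-%R : measurableTypeR R -> measurableTypeR R)]_(x in C)
    (normal_pdf 0 s x)%:E)%E; last first.
  by apply: eq_measure_integral => A mA _; exact: lebesgue_measureN.
rewrite (ge0_integral_pushforward mN lebesgue_measure mC).
- by apply: eq_integral => x _ /=; rewrite pdfN.
- by apply: measurable_funTS; apply/measurable_EFinP; exact: measurable_normal_pdf.
- by move=> x _; rewrite lee_fin normal_pdf_ge0.
Qed.

(** Mills' inequality. On [t, +oo[ the density is at most its product with
    x / t, which has an explicit primitive. *)
Lemma normal_prob_tail (R : realType) (s t : R) : 0 < s -> 0 < t ->
  (normal_prob 0 s `]t, +oo[ <=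
   (s / t * (Num.sqrt (pi *+ 2))^-1 * expR (- (t / s) ^+ 2 / 2))%:E)%E.
Proof.
move=> s0 t0; set c := (Num.sqrt (pi *+ 2))^-1.
have c0 : 0 < c by rewrite invr_gt0 sqrtr_gt0 mulrn_wgt0 ?pi_gt0.
pose g (x : R) := expR (- x ^+ 2 / (s ^+ 2 *+ 2)).
pose f (x : R) : R := x / t * (s^-1 * c * g x).
pose F (x : R) : R := - (s / t * c * g x).
have cg : continuous g.
  move=> x; apply: continuous_comp; last exact: continuous_expR.
  by apply: cvgM; [apply: cvgN; exact: exprn_continuous|exact: cvg_cst].
have dg (x : R) : is_derive x 1 g (- x / s ^+ 2 * g x).
  rewrite /g; apply: is_derive_eq.
  rewrite !scaler0 !(addr0,add0r) !scaler1 /GRing.scale/=.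
  rewrite -mulr_natr; set e := expR _; field.
  by rewrite gt_eqF.
have FTC : (\int[lebesgue_measure]_(x in `[t, +oo[) (f x)%:E = 0%:E - (F t)%:E)%E.
  apply: ge0_continuous_FTC2y.
  - move=> x tx; apply: mulr_ge0.
      by apply: divr_ge0; [exact: le_trans (ltW t0) tx|exact: ltW].
    apply: mulr_ge0; last exact: expR_ge0.
    by apply: mulr_ge0; [rewrite invr_ge0; exact: ltW|exact: ltW].
  - apply: continuous_subspaceT => x; apply: cvgM.
      by apply: cvgM; [exact: cvg_id|exact: cvg_cst].
    by apply: cvgM; [exact: cvg_cst|exact: cg].
  - rewrite -oppr0; apply: cvgN; rewrite -(mulr0 (s / t * c)); apply: cvgM.
      exact: cvg_cst.
    rewrite /g (_ : (fun x : R => _) =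
        (fun x => expR (- x)) \o (fun x => x ^+ 2 / (s ^+ 2 *+ 2))); last first.
      by apply/funext => x /=; rewrite mulNr.
    apply: (cvg_comp _ _ _ (@cvgr_expR R)).
    apply: gt0_cvgMly; last exact: cvgr_expr2.
    by rewrite invr_gt0 mulrn_wgt0 ?exprn_gt0.
  - by move=> x _; rewrite /F; apply: ex_derive.
  - apply: cvg_at_right_filter; apply: cvgN; apply: cvgM; [exact: cvg_cst|exact: cg].
  - move=> x _; rewrite derive1E /F; apply: derive_val.
    have dgx := dg x; apply: is_derive_eq.
    rewrite /GRing.scale/= /f.
    by field; rewrite !gt_eqF.
apply: (@le_trans _ _ (\int[lebesgue_measure]_(x in `[t, +oo[) (f x)%:E)%E).
  apply: (@le_trans _ _
    (\int[lebesgue_measure]_(x in `[t, +oo[) (normal_pdf 0 s x)%:E)%E).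
    apply: ge0_subset_integral => //=.
    - by apply: measurable_funTS; apply/measurable_EFinP; exact: measurable_normal_pdf.
    - by move=> x _; rewrite lee_fin normal_pdf_ge0.
    - by move=> x /=; rewrite !in_itv/= !andbT; exact: ltW.
  apply: ge0_le_integral => //=.
  - by move=> x _; rewrite lee_fin normal_pdf_ge0.
  - by apply: measurable_funTS; apply/measurable_EFinP; exact: measurable_normal_pdf.
  - apply: measurable_funTS; apply/measurable_EFinP.
    by apply: measurable_funM => //; apply: measurable_funM => //;
      exact: continuous_measurable_fun.
  - move=> x; rewrite in_itv/= andbT => tx.
    rewrite lee_fin normal_pdf_explicit// subr0 /f -/c -/(g x).
    rewrite ler_peMl ?ler_pdivlMr ?mul1r// mulr_ge0 ?expR_ge0//.
    by rewrite mulr_ge0 ?invr_ge0 ?(ltW s0)// (ltW c0).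
rewrite FTC /F /g -EFinB lee_fin sub0r opprK.
rewrite le_eqVlt; apply/orP; left; apply/eqP; congr (_ * expR _).
by field; rewrite gt_eqF.
Qed.

(** * Linear and quadratic functions of a white Gaussian vector *)

Lemma measurable_forall (d : measure_display) (T : measurableType d)
    (I : finType) (F : I -> set T) :
  (forall i, measurable (F i)) -> measurable [set t | forall i, F i t].
Proof.
move=> mF; rewrite (_ : [set t | _] = \bigcap_(i in [set: I]) F i).
  by apply: fin_bigcap_measurable.
by apply/seteqP; split=> t /= Ft i; [move=> _|]; exact: Ft.
Qed.

Lemma measure_bigU_le (d : measure_display) (T : measurableType d) (R : realType)
    (P : {measure set T -> \bar R}) (I : finType) (p : pred I) (F : I -> set T) :
  (forall i, measurable (F i)) ->
  (P (\big[setU/set0]_(i | p i) F i) <= \sum_(i | p i) P (F i))%E.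
Proof.
move=> mF.
suff [] : measurable (\big[setU/set0]_(i | p i) F i) /\
  (P (\big[setU/set0]_(i | p i) F i) <= \sum_(i | p i) P (F i))%E by [].
elim/big_rec2: _ => [|i y B _ [mB PB]]; first by rewrite measure0.
split; first exact: measurableU.
exact: (le_trans (measureU2 P (mF i) mB) (leeD2l _ PB)).
Qed.

Section white_noise.
Context (R : realType) (d : measure_display) (T : measurableType d).
Context (P : probability T R) (n : nat) (w : 'I_n -> {RV P >-> R}) (sigma : R).
Context (sigma0 : 0 < sigma) (hw : white_gaussian w sigma).

Lemma white_gaussianE (B : 'I_n -> set R) : (forall i, measurable (B i)) ->
  P [set t | forall i, B i (w i t)] = (\prod_(i < n) normal_prob 0 sigma (B i))%E.
Proof.
case: hw => hd hi mB; rewrite hi//; apply: eq_bigr => i _.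
by rewrite -(hd i).
Qed.

(** The joint statement with the unused coordinates is what makes the
    induction on l go through: for fixed B, the partial sum and the next
    coordinate have a joint law that agrees on rectangles with a product of
    normal laws, up to the constant factor q. *)
Lemma linear_combination_joint (c : 'I_n -> R) (i0 : 'I_n) (l : seq 'I_n)
    (C : set R) (B : 'I_n -> set R) :
  uniq (i0 :: l) -> measurable C -> (forall i, measurable (B i)) ->
  (forall i, i \in i0 :: l -> B i = setT) ->
  P [set t | C (w i0 t + \sum_(i <- l) c i * w i t) /\
             forall i, B i (w i t)] =
  (normal_prob 0 (Num.sqrt (sigma ^+ 2 * (1 + \sum_(i <- l) c i ^+ 2))) C *
   \prod_(i < n) normal_prob 0 sigma (B i))%E.
Proof.
elim: l C B => [|k l IH] C B ul mC mB BT.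
  pose B' i := if i == i0 then C else B i.
  have mB' i : measurable (B' i) by rewrite /B'; case: ifP.
  rewrite big_nil addr0 mulr1 sqrtr_sqr gtr0_norm//.
  rewrite (_ : [set t | _] = [set t | forall i, B' i (w i t)]); last first.
    apply/seteqP; split=> t /=.
      by rewrite big_nil addr0 => -[Ct Bt] i; rewrite /B'; case: eqP => [->|].
    move=> Bt; split.
      by have := Bt i0; rewrite /B' eqxx big_nil addr0.
    move=> i; have := Bt i; rewrite /B'; case: eqP => // -> _.
    by rewrite BT ?mem_head.
  rewrite white_gaussianE// (bigD1 i0)//= [in RHS](bigD1 i0)//=.
  rewrite /B' eqxx BT ?mem_head//.
  rewrite -[normal_prob 0 sigma setT]/(normal_prob 0 sigma setT).
  rewrite probability_setT mul1e.
  by congr (_ * _)%E; apply: eq_bigr => i /negbTE ->.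
pose X t := w i0 t + \sum_(i <- l) c i * w i t.
pose S := Num.sqrt (sigma ^+ 2 * (1 + \sum_(i <- l) c i ^+ 2)).
have V0 : 0 < sigma ^+ 2 * (1 + \sum_(i <- l) c i ^+ 2).
  rewrite mulr_gt0 ?exprn_gt0// ltr_wpDr// sumr_ge0// => i _.
  exact: sqr_ge0.
have S0 : 0 < S by rewrite sqrtr_gt0.
have SE : S ^+ 2 = sigma ^+ 2 * (1 + \sum_(i <- l) c i ^+ 2).
  exact: sqr_sqrtr (ltW V0).
have mX : measurable_fun [set: T] X.
  apply: measurable_funD => //; apply: measurable_sum => i.
  exact: measurable_funM.
pose Z t : measurableTypeR R * measurableTypeR R := (X t, w k t : R).
have mZ : measurable_fun [set: T] Z.
  apply: measurable_fun_pair; first exact: mX.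
  exact: (measurable_funP (w k)).
pose E := [set t | forall i, B i (w i t)].
have mE : measurable E.
  apply: measurable_forall => i.
  by rewrite -[X in measurable X]setTI; exact: (measurable_funP (w i)).
have q_fin : (\prod_(i < n) normal_prob 0 sigma (B i))%E \is a fin_num.
  apply: (big_ind (fun x => x \is a fin_num)) => [//|x y|i _].
    exact: fin_numM.
  exact: (@fin_num_measure _ _ _ (normal_prob 0 sigma) (B i) (mB i)).
have q_ge0 : 0 <= fine (\prod_(i < n) normal_prob 0 sigma (B i))%E.
  by apply: fine_ge0; apply: prode_ge0 => i _; exact: measure_ge0.
set q := (\prod_(i < n) normal_prob 0 sigma (B i))%E in q_fin q_ge0 *.
pose M := pushforward (mrestr P mE) Z.
pose N := normal_prob 0 S; pose Nk := normal_prob 0 sigma.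
(* As q = P E, the product m1 \x Nk has the total mass of M. *)
pose m1 := mscale (NngNum q_ge0) N.
pose D := [set p : measurableTypeR R * measurableTypeR R | C (p.1 + c k * p.2)].
have mD : measurable D.
  rewrite -[X in measurable X]setTI.
  apply: (_ : measurable_fun setT
    (fun p : measurableTypeR R * measurableTypeR R => p.1 + c k * p.2)) => //.
  by apply: measurable_funD => //; exact: measurable_funM.
transitivity (M D).
  rewrite /M /pushforward /mrestr; congr (P _).
  apply/seteqP; split=> t; rewrite /D /Z /X /E /= big_cons;
    by rewrite -addrA [_ + c k * _]addrC.
have HM : (m1 \x Nk)%E D = pushforward (mrestr P mE) Z D.
  apply: product_measure_unique => //.
  move=> C1 C2 mC1 mC2.
  pose B' i := if i == k then C2 else B i.
  have mB' i : measurable (B' i).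
    by rewrite /B'; case: ifP => _; [exact: mC2|exact: mB].
  have ul' : uniq (i0 :: l).
    by move: ul; rewrite /= inE negb_or => /andP[/andP[_ ->] /andP[_ ->]].
  have B'T i : i \in i0 :: l -> B' i = setT.
    move=> il; rewrite /B'; case: eqP => [ik|_].
      move: ul il; rewrite ik /= !inE negb_or.
      by rewrite eq_sym => /andP[/andP[/negbTE-> _] /andP[/negbTE-> _]].
    by apply: BT; move: il; rewrite !inE => /orP[->|->]; rewrite ?orbT.
  transitivity (P [set t | C1 (w i0 t + \sum_(i <- l) c i * w i t) /\
             forall i, B' i (w i t)]).
    rewrite /pushforward /mrestr; congr (P _).
    apply/seteqP; split=> t; rewrite /Z /X /E /=.
      move=> [[h1 h2] h3]; split=> // i; rewrite /B'.
      by case: eqP => [->|].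
    move=> [h1 h2]; split; first split=> //.
      by have := h2 k; rewrite /B' eqxx.
    move=> i; have := h2 i; rewrite /B'; case: eqP => // -> _.
    by rewrite BT// !inE eqxx orbT.
  rewrite (IH C1 B' ul' mC1 mB' B'T).
  rewrite -[RHS]/((fine q)%:E * normal_prob 0 S C1 * normal_prob 0 sigma C2)%E.
  rewrite fineK// [X in (_ * X)%E](bigD1 k)//=.
  rewrite /q [in RHS](bigD1 k)//= BT ?inE ?eqxx ?orbT//.
  rewrite -[normal_prob 0 sigma setT]/(normal_prob 0 sigma setT).
  rewrite probability_setT mul1e /B' eqxx.
  rewrite [X in (_ * (_ * X))%E](eq_bigr (fun i => normal_prob 0 sigma (B i))).
    by rewrite muleCA muleC; congr (_ * _)%E; rewrite muleC.
  by move=> i /negbTE->.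
transitivity ((m1 \x Nk)%E D); first exact: esym HM.
have mD2 : measurable_fun [set: measurableTypeR R]
    (normal_prob 0 sigma \o xsection D).
  exact: measurable_fun_xsection.
rewrite /product_measure1 ge0_integral_mscale//=.
rewrite fineK// -/q muleC; congr (_ * _)%E.
transitivity (normal_prob 0 (Num.sqrt (S ^+ 2 + c k ^+ 2 * sigma ^+ 2)) C).
  exact: normal_prob_convolution S0 sigma0 mC.
congr (normal_prob 0 (Num.sqrt _) C).
by rewrite SE big_cons; ring.
Qed.

Definition noise_vector (t : T) : 'cV[R]_n := \col_(i < n) w i t.
Local Notation W := noise_vector.

Lemma measurable_dot_noise (theta : 'cV[R]_n) :
  measurable_fun [set: T] (fun t => dot theta (W t)).
Proof.
apply: measurable_sum => i; apply: measurable_funM => //.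
by rewrite (_ : (fun t => W t i 0) = w i)//; apply/funext => t; rewrite mxE.
Qed.

Lemma dot_noise_law (theta : 'cV[R]_n) (i0 : 'I_n) (C : set R) :
  theta i0 0 = 1 -> measurable C ->
  P [set t | C (dot theta (W t))] =
  normal_prob 0 (Num.sqrt (sigma ^+ 2 * dot theta theta)) C.
Proof.
move=> th1 mC; pose l := [seq i <- enum 'I_n | i != i0].
have ul : uniq (i0 :: l) by rewrite /= filter_uniq ?enum_uniq// mem_filter eqxx.
have := linear_combination_joint (fun i => theta i 0) ul mC
  (B := fun=> setT) (fun=> measurableT) (fun _ _ => erefl).
rewrite [X in (_ * X)%E]big1; last first.
  by move=> i _; exact: (@probability_setT _ _ _ (normal_prob 0 sigma)).
have dE (v : 'cV[R]_n) : dot theta v = v i0 0 + \sum_(i <- l) theta i 0 * v i 0.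
  by rewrite /dot (bigD1 i0)//= th1 mul1r big_filter big_enum_cond.
have -> : 1 + \sum_(i <- l) theta i 0 ^+ 2 = dot theta theta.
  by rewrite dE th1; congr (_ + _); apply: eq_bigr => i _; rewrite expr2.
rewrite mule1 => <-; congr (P _); apply/seteqP.
have WE t : dot theta (W t) = w i0 t + \sum_(i <- l) theta i 0 * w i t.
  by rewrite dE mxE; congr (_ + _); apply: eq_bigr => i _; rewrite mxE.
split=> t /=; rewrite WE; first by move=> ?; split.
by case.
Qed.

Lemma dot_noise_tail (theta : 'cV[R]_n) (x : R) :
  dot theta theta <= 1 -> 0 < x ->
  (P [set t | (x * sigma < `|dot theta (W t)|)%R] <=
   (2 * (x^-1 * (Num.sqrt (pi *+ 2))^-1 * expR (- x ^+ 2 / 2)))%R%:E)%E.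
Proof.
move=> th1 x0; set c := (Num.sqrt _)^-1.
have c0 : 0 < c by rewrite invr_gt0 sqrtr_gt0 mulrn_wgt0 ?pi_gt0.
have [->|th0] := eqVneq theta 0.
  rewrite (_ : [set t | _] = set0) ?measure0.
    rewrite lee_fin; apply: mulr_ge0 => //; apply: mulr_ge0; last exact: expR_ge0.
    by apply: mulr_ge0; [rewrite invr_ge0; exact: ltW|exact: ltW].
  apply/seteqP; split=> t //=; rewrite dot0l normr0 ltNge => /negP[].
  by rewrite mulr_ge0// ltW.
have [a [th' [i0 [a0 thE th'1]]]] := scale_unit_coord th0.
set S := Num.sqrt (sigma ^+ 2 * dot th' th').
have th'0 : 0 < dot th' th'.
  apply: dot_gt0; apply/eqP => h; move: th'1; rewrite h mxE => /eqP.
  by rewrite eq_sym oner_eq0.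
have V0 : 0 < sigma ^+ 2 * dot th' th' by rewrite mulr_gt0 ?exprn_gt0.
have S0 : 0 < S by rewrite sqrtr_gt0.
have aS : `|a| * S <= sigma.
  rewrite -(@ler_pXn2r _ 2) ?nnegrE ?mulr_ge0 ?(ltW S0) ?(ltW sigma0)//.
  rewrite exprMn real_normK ?num_real// (sqr_sqrtr (ltW V0)).
  move: th1; rewrite thE dotZl dotZr => h.
  by rewrite mulrCA ler_piMr ?sqr_ge0// expr2 -mulrA.
set tau := x * sigma / `|a|.
have tau0 : 0 < tau by rewrite divr_gt0 ?normr_gt0// mulr_gt0.
have xtau : x <= tau / S.
  rewrite ler_pdivlMr// ler_pdivlMr ?normr_gt0// -mulrA.
  by rewrite ler_wpM2l ?(ltW x0)// mulrC.
pose C := [set z : R | tau < z].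
have CE : C = `]tau, +oo[%classic.
  by apply/seteqP; split=> z /=; rewrite in_itv/= andbT.
have mC : measurable C by rewrite CE.
have mC' : measurable [set z : R | C (- z)].
  rewrite -[X in measurable X]setTI.
  exact: (_ : measurable_fun setT (-%R : R -> R)).
rewrite (_ : [set t | _] = [set t | (C `|` [set z | C (- z)]) (dot th' (W t))]).
  rewrite (dot_noise_law th'1); last exact: measurableU.
  apply: (le_trans (measureU2 (normal_prob 0 S) mC mC')).
  have h := normal_prob_tail S0 tau0; rewrite -CE in h.
  have hN : (normal_prob 0 S [set z : R | C (- z)%R] <=
      (S / tau * c * expR (- (tau / S) ^+ 2 / 2))%R%:E)%E.
    by rewrite normal_probN.
  apply: (le_trans (leeD h hN)); rewrite -EFinD lee_fin mulr_natl mulr2n.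
  have K : S / tau * c * expR (- (tau / S) ^+ 2 / 2) <=
      x^-1 * c * expR (- x ^+ 2 / 2).
    have tS0 : 0 < tau / S by exact: lt_le_trans x0 xtau.
    apply: ler_pM; [|exact: expR_ge0| |].
    - by apply: mulr_ge0; [exact: divr_ge0 (ltW S0) (ltW tau0)|exact: ltW].
    - by rewrite ler_pM2r// -[S / tau]invrK invf_div lef_pV2.
    - rewrite ler_expR ler_pM2r ?invr_gt0// lerN2 ler_pXn2r ?nnegrE//; exact: ltW.
  by apply: lerD.
apply/seteqP; split=> t /=; rewrite thE dotZl normrM /tau => /=.
  rewrite [ltRHS]mulrC -ltr_pdivrMr ?normr_gt0// -/tau /C /= => h.
  by have [] := lerP 0 (dot th' (W t)) => h'; [left|right];
    rewrite ?(ger0_norm h') ?(ltr0_norm h') in h.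
move=> h; rewrite [ltRHS]mulrC -ltr_pdivrMr ?normr_gt0// -/tau.
by case: h => /= h; rewrite (lt_le_trans h)// ?ler_norm// -normrN ler_norm.
Qed.

Lemma dot_noise_mgf (theta : 'cV[R]_n) :
  (\int[P]_t (expR (dot theta (W t)))%:E =
   (expR (sigma ^+ 2 * dot theta theta / 2))%:E)%E.
Proof.
have [->|th0] := eqVneq theta 0.
  under eq_integral do rewrite dot0l expR0.
  rewrite integral_cst//= mul1e dot0l mulr0 mul0r expR0.
  by rewrite probability_setT.
have [a [th' [i0 [a0 thE th'1]]]] := scale_unit_coord th0.
set S := Num.sqrt (sigma ^+ 2 * dot th' th').
have th'0 : 0 < dot th' th'.
  apply: dot_gt0; apply/eqP => h; move: th'1; rewrite h mxE => /eqP.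
  by rewrite eq_sym oner_eq0.
have V0 : 0 < sigma ^+ 2 * dot th' th' by rewrite mulr_gt0 ?exprn_gt0.
have S0 : 0 < S by rewrite sqrtr_gt0.
pose f (z : measurableTypeR R) := (expR (a * z + 0 * z ^+ 2))%:E.
have mf : measurable_fun setT f.
  apply/measurable_EFinP; apply: measurableT_comp => //.
  apply: measurable_funD; first exact: measurable_funM.
  by apply: measurable_funM => //; exact: measurable_funX.
have mX : @measurable_fun _ _ _ (measurableTypeR R) [set: T]
    (fun t => dot th' (W t)) := measurable_dot_noise th'.
transitivity (\int[pushforward P
  (fun t => dot th' (W t) : measurableTypeR R)]_z f z)%E.
  rewrite (ge0_integral_pushforward mX P measurableT mf)//; last first.
    by move=> z _; rewrite lee_fin expR_ge0.
  by apply: eq_integral => t _; rewrite /f /= mul0r addr0 thE dotZl.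
transitivity (\int[normal_prob 0 S]_z f z)%E.
  apply: eq_measure_integral => A mA _.
  exact: (dot_noise_law th'1 mA).
rewrite ge0_integral_normal_prob//; last by move=> z; rewrite lee_fin expR_ge0.
under eq_integral do rewrite -EFinM.
rewrite integral_expR_quadratic_normal_pdf// ?mulr0 ?mul0r ?subr0//.
rewrite sqrtr1 invr1 mul1r (sqr_sqrtr (ltW V0)) mulr1 thE dotZl dotZr.
suff -> : sigma ^+ 2 * (a * (a * dot th' th')) =
  a ^+ 2 * (sigma ^+ 2 * dot th' th') by [].
by ring.
Qed.

(** Gaussian linearization: exp (lam X^2) is the mean of exp (k g X) over a
    standard normal g, with k^2 = 2 lam. For X = <u, w>, exchanging the
    integrals shifts theta by k g u, which does not affect the remaining
    squares because u is orthogonal to the rest of the family. The linear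
    term theta is there for the induction. This avoids the rotation
    invariance of the law of w. *)
Lemma dot_noise_sqr_mgf (us : seq 'cV[R]_n) (lam : R) (theta : 'cV[R]_n) :
  orthonormal_seq us -> 0 <= lam -> 0 < 1 - 2 * (lam * sigma ^+ 2) ->
  (\int[P]_t (expR (dot theta (W t) + lam * \sum_(u <- us) dot u (W t) ^+ 2))%:E =
   ((Num.sqrt (1 - 2 * (lam * sigma ^+ 2)))^-1 ^+ size us *
     expR (sigma ^+ 2 * dot theta theta / 2 +
       lam * sigma ^+ 4 / (1 - 2 * (lam * sigma ^+ 2)) *
         \sum_(u <- us) dot u theta ^+ 2))%:E)%E.
Proof.
move=> + lam0 D0; set D := 1 - _ in D0 *.
elim: us theta => [|u us IH] theta.
  move=> _; under eq_integral do rewrite big_nil mulr0 addr0.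
  by rewrite dot_noise_mgf big_nil mulr0 addr0 expr0 mul1r.
move=> [u1 uo /IH{}IH].
pose k := Num.sqrt (2 * lam).
have k2 : k ^+ 2 = 2 * lam by rewrite sqr_sqrtr// mulr_ge0.
pose f (p : T * measurableTypeR R) :=
  (expR (dot (theta + (k * p.2) *: u) (W p.1) +
     lam * \sum_(v <- us) dot v (W p.1) ^+ 2))%:E.
have mW v : measurable_fun setT (fun p : T * measurableTypeR R => dot v (W p.1)).
  exact: (measurableT_comp (measurable_dot_noise v) measurable_fst).
have mf : measurable_fun setT f.
  apply/measurable_EFinP; apply: measurableT_comp => //.
  apply: measurable_funD.
    rewrite (_ : (fun p => _) = (fun p : T * measurableTypeR R =>
       dot theta (W p.1) + k * p.2 * dot u (W p.1))).
      apply: measurable_funD; first exact: mW.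
      apply: measurable_funM; last exact: mW.
      by apply: measurable_funM => //; exact: measurable_snd.
    by apply/funext => p; rewrite dotDl dotZl.
  apply: measurable_funM => //; apply: measurable_sum => v.
  by apply: measurable_funX; exact: mW.
have f0 p : (0 <= f p)%E by rewrite lee_fin expR_ge0.
transitivity (\int[P]_t \int[normal_prob 0 1]_g f (t, g))%E.
  apply: eq_integral => t _; rewrite ge0_integral_normal_prob//; last first.
    exact: measurable_fun_pair2 mf.
  set c := dot theta (W t) + lam * \sum_(v <- us) dot v (W t) ^+ 2.
  transitivity (\int[lebesgue_measure]_g ((expR c)%:E *
    (expR (k * dot u (W t) * g + 0 * g ^+ 2) * normal_pdf 0 1 g)%:E))%E.
    rewrite ge0_integralZl//; first last.
    - by move=> g _; rewrite lee_fin mulr_ge0 ?expR_ge0 ?normal_pdf_ge0.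
    - apply/measurable_EFinP; apply: measurable_funM; last exact: measurable_normal_pdf.
      apply: measurableT_comp => //; apply: measurable_funD.
        exact: measurable_funM.
      by apply: measurable_funM => //; exact: measurable_funX.
    rewrite integral_expR_quadratic_normal_pdf// ?mulr0 ?mul0r ?subr0//.
    rewrite sqrtr1 invr1 mul1r -EFinM -expRD big_cons exprMn k2.
    by congr (expR _)%:E; rewrite /c; field.
  apply: eq_integral => g _; rewrite -EFinM /f /= mulrA -expRD dotDl dotZl.
  by congr (expR _ * _)%:E; rewrite /c; ring.
rewrite (fubini_tonelli f mf f0).
transitivity (\int[normal_prob 0 1]_g
   (((Num.sqrt D)^-1 ^+ size us *
     expR (sigma ^+ 2 * dot (theta + (k * g) *: u) (theta + (k * g) *: u) / 2 +
       lam * sigma ^+ 4 / D * \sum_(v <- us) dot v theta ^+ 2))%:E))%E.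
  apply: eq_integral => g _; rewrite /f /= IH; congr (_ * expR (_ + _ * _))%:E.
  rewrite !big_seq; apply: eq_bigr => v vus.
  by rewrite dotDr dotZr (uo _ vus) mulr0 addr0.
set c := sigma ^+ 2 * dot theta theta / 2 +
  lam * sigma ^+ 4 / D * \sum_(v <- us) dot v theta ^+ 2.
have K0 : 0 <= (Num.sqrt D)^-1 ^+ size us * expR c.
  by rewrite mulr_ge0 ?expR_ge0// exprn_ge0// invr_ge0 sqrtr_ge0.
have mg (a b : R) : measurable_fun [set: measurableTypeR R]
    (fun g : measurableTypeR R => expR (b * g + a * g ^+ 2)).
  apply: measurableT_comp => //; apply: measurable_funD.
    exact: measurable_funM.
  by apply: measurable_funM => //; exact: measurable_funX.
pose b := sigma ^+ 2 * k * dot u theta.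
transitivity (\int[lebesgue_measure]_g
   (((Num.sqrt D)^-1 ^+ size us * expR c)%:E *
    (expR (b * g + lam * sigma ^+ 2 * g ^+ 2) * normal_pdf 0 1 g)%:E))%E.
  rewrite ge0_integral_normal_prob; first last.
  - by move=> g; rewrite lee_fin mulr_ge0 ?expR_ge0// exprn_ge0// invr_ge0 sqrtr_ge0.
  - apply/measurable_EFinP; apply: measurable_funM => //.
    apply: measurableT_comp => //; apply: measurable_funD => //.
    apply: measurable_funM => //; apply: measurable_funM => //.
    rewrite (_ : (fun g => _) = (fun g : R =>
       dot theta theta + 2 * k * dot u theta * g + k ^+ 2 * g ^+ 2)).
      apply: measurable_funD; last first.
        by apply: measurable_funM => //; exact: measurable_funX.
      by apply: measurable_funD => //; exact: measurable_funM.
    apply/funext => g; rewrite !(dotDl, dotDr, dotZl, dotZr) u1 (dotC theta u).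
    by ring.
  apply: eq_integral => g _; rewrite -!EFinM; congr (_%:E).
  rewrite [RHS]mulrA -[in RHS](mulrA _ (expR c)) -expRD.
  congr (_ * expR _ * _).
  rewrite /c /b !(dotDl, dotDr, dotZl, dotZr) u1 (dotC theta u).
  transitivity (sigma ^+ 2 * dot theta theta / 2 +
    lam * sigma ^+ 4 / D * (\sum_(v <- us) dot v theta ^+ 2) +
    (sigma ^+ 2 * k * dot u theta * g + k ^+ 2 / 2 * sigma ^+ 2 * g ^+ 2)).
    by field; rewrite gt_eqF.
  by rewrite k2; field; rewrite gt_eqF.
rewrite ge0_integralZl//; first last.
- by move=> g _; rewrite lee_fin mulr_ge0 ?expR_ge0 ?normal_pdf_ge0.
- by apply/measurable_EFinP; apply: measurable_funM => //; exact: measurable_normal_pdf.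
have DE : 1 - 2 * (lam * sigma ^+ 2) * 1 ^+ 2 = D by rewrite /D; ring.
rewrite integral_expR_quadratic_normal_pdf ?DE// -EFinM; congr (_%:E).
rewrite [size _]/= (exprS _ (size us)) big_cons.
set E0 := sigma ^+ 2 * _ / 2 + _.
have -> : E0 = c + b ^+ 2 * 1 ^+ 2 / (2 * D).
  rewrite /E0 /c /b !exprMn k2; field; rewrite gt_eqF//.
by rewrite [in RHS]expRD [LHS]mulrACA; congr (_ * _); exact: mulrC.
Qed.

(** Markov's inequality for exp (lam Y) - 1, where Y is the sum of squares and
    lam is chosen so that the moment of exp (lam Y) is q^(size us). As q tends
    to 1 this becomes the Markov bound 1 / 2; q = sqrt 2 gives the Chernoff
    bound. *)
Lemma sum_sqr_dot_noise_tail (us : seq 'cV[R]_n) (s : nat) (q : R) :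
  orthonormal_seq us -> (size us <= s)%N -> 1 < q ->
  1 + (expR (1 - q ^- 2) ^+ s - 1) *
    fine (P [set t | 2 * s%:R * sigma ^+ 2 < \sum_(u <- us) dot u (W t) ^+ 2])
  <= q ^+ s.
Proof.
move=> uo us_s q1; have q0 : 0 < q by exact: lt_trans q1.
pose lam := (1 - q ^- 2) / (2 * sigma ^+ 2).
have q2 : q ^- 2 < 1 by rewrite invf_lt1 ?exprn_gt0// exprn_egt1.
have lam0 : 0 < lam by rewrite divr_gt0 ?subr_gt0// mulr_gt0// exprn_gt0.
have DE : 1 - 2 * (lam * sigma ^+ 2) = q ^- 2.
  by rewrite /lam; field; rewrite !gt_eqF.
have := dot_noise_sqr_mgf 0 uo (ltW lam0).
rewrite DE invr_gt0 exprn_gt0// => /(_ isT).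
rewrite dot0r mulr0 mul0r big1_seq; last by move=> u _; rewrite dot0r expr0n.
rewrite mulr0 addr0 expR0 mulr1 sqrtrV ?exprn_ge0 ?(ltW q0)//.
rewrite sqrtr_sqr gtr0_norm// invrK => mgfE.
set A := [set t | _].
pose Y t := \sum_(u <- us) dot u (W t) ^+ 2.
have mY : measurable_fun setT Y.
  by apply: measurable_sum => u; apply: measurable_funX; exact: measurable_dot_noise.
have mA : measurable A.
  rewrite (_ : A = Y @^-1` `]2 * s%:R * sigma ^+ 2, +oo[); last first.
    by apply/seteqP; split=> t; rewrite /A /= in_itv/= andbT.
  by rewrite -[X in measurable X]setTI; exact: mY.
have E1 : 1 <= expR (1 - q ^- 2) ^+ s.
  by rewrite exprn_ege1// -[leLHS]expR0 ler_expR subr_ge0 ltW.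
have : (\int[P]_t (1 + (expR (1 - q ^- 2) ^+ s - 1)%:E * (\1_A t)%:E) <=
        (q ^+ size us)%:E)%E.
  rewrite -mgfE; apply: ge0_le_integral => //.
  - move=> t _; rewrite -EFinM -EFinD lee_fin.
    by rewrite addr_ge0// mulr_ge0// subr_ge0.
  - apply: emeasurable_funD => //; apply/measurable_EFinP.
    by apply: measurable_funM => //; exact: measurable_indic.
  - apply/measurable_EFinP; apply: measurableT_comp => //.
    apply: measurable_funD; first exact: measurable_dot_noise.
    exact: measurable_funM.
  - move=> t _; rewrite -EFinM -EFinD lee_fin dot0l add0r.
    rewrite indicE; case: (boolP (t \in A)) => [|_].
      rewrite inE /A /= mulr1 addrC subrK -expRM_natl ler_expR => h.
      apply: (@le_trans _ _ (lam * (2 * s%:R * sigma ^+ 2))).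
        rewrite /lam le_eqVlt; apply/orP; left; apply/eqP.
        by field; rewrite !gt_eqF.
      by rewrite ler_wpM2l// ltW.
    rewrite mulr0 addr0 -[leLHS]expR0 ler_expR.
    apply: mulr_ge0; first exact: ltW.
    by apply: sumr_ge0 => u _; exact: sqr_ge0.
rewrite ge0_integralD//; last 2 first.
- by move=> t _; rewrite mule_ge0 ?lee_fin ?subr_ge0.
- by apply: emeasurable_funM => //; apply/measurable_EFinP; exact: measurable_indic.
rewrite integral_cst// mul1e ge0_integralZl//; last 2 first.
- by apply/measurable_EFinP; exact: measurable_indic.
- by rewrite lee_fin subr_ge0.
rewrite integral_indic// setIT.
rewrite -[X in (X + _)%E]/(P setT) probability_setT => h.
have Pfin : P A \is a fin_num by exact: fin_num_measure.
move: h; rewrite -[X in (_ * X)%E]fineK// -EFinM -EFinD lee_fin => h.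
apply: (le_trans h); rewrite ler_weXn2l//; exact: ltW.
Qed.

(** Union bound over the two kinds of exceptional events. *)
Lemma good_noise_event (I : finType) (p : pred I) (theta : I -> 'cV[R]_n)
    (us : seq 'cV[R]_n) (x v : R) :
  (forall i, dot (theta i) (theta i) <= 1) -> 0 < x ->
  exists E : set T, [/\ measurable E,
    forall t, E t -> (forall i, p i -> `|dot (theta i) (W t)| <= x * sigma) /\
                     \sum_(u <- us) dot u (W t) ^+ 2 <= v &
    ((1 - #|p|%:R * (2 * (x^-1 * (Num.sqrt (pi *+ 2))^-1 * expR (- x ^+ 2 / 2)))
        - fine (P [set t | (v < \sum_(u <- us) dot u (W t) ^+ 2)%R]))%R%:E
     <= P E)%E].
Proof.
move=> th1 xpos.
pose bad i := [set t | x * sigma < `|dot (theta i) (W t)|].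
pose bad2 := [set t | v < \sum_(u <- us) dot u (W t) ^+ 2].
have mbad i : measurable (bad i).
  rewrite (_ : bad i =
    (fun t => `|dot (theta i) (W t)|) @^-1` `]x * sigma, +oo[); last first.
    by apply/seteqP; split=> t; rewrite /bad /= in_itv/= andbT.
  rewrite -[X in measurable X]setTI; apply: (_ : measurable_fun setT _) => //.
  by apply: measurableT_comp => //; exact: measurable_dot_noise.
have mbad2 : measurable bad2.
  rewrite (_ : bad2 = (fun t => \sum_(u <- us) dot u (W t) ^+ 2) @^-1`
      `]v, +oo[); last first.
    by apply/seteqP; split=> t; rewrite /bad2 /= in_itv/= andbT.
  rewrite -[X in measurable X]setTI; apply: (_ : measurable_fun setT _) => //.
  by apply: measurable_sum => u; apply: measurable_funX; exact: measurable_dot_noise.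
pose B1 := \big[setU/set0]_(i | p i) bad i.
have mB1 : measurable B1 by apply: bigsetU_measurable.
exists (~` (B1 `|` bad2)); split.
- by apply: measurableC; exact: measurableU.
- move=> t /= /not_orP[nB1 nB2]; split.
    move=> i pi; rewrite leNgt; apply/negP => h; apply: nB1.
    by rewrite /B1 (bigD1 i)//=; left.
  by rewrite leNgt; apply/negP.
- rewrite probability_setC; last exact: measurableU.
  set K : R := 2 * _; rewrite -addrA -opprD EFinB; apply: leeB => //.
  have P2 : P bad2 \is a fin_num by exact: fin_num_measure.
  rewrite EFinD [X in (_ <= _ + X)%E]fineK//.
  apply: (le_trans (measureU2 P mB1 mbad2)); apply: leeD => //.
  apply: (le_trans (measure_bigU_le _ _ mbad)).
  apply: (@le_trans _ _ (\sum_(i | p i) K%:E)%E).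
    by apply: lee_sum => i _; exact: dot_noise_tail.
  by rewrite sumEFin (eq_bigl (mem p))// sumr_const mulr_natl.
Qed.

End white_noise.

(** * Numerical bounds *)

Lemma sin_le_id (R : realType) (y : R) : 0 <= y -> sin y <= y.
Proof.
move=> y0.
have [c _] : exists2 c, c \in `[0, y] & sin y - sin 0 = cos c * (y - 0).
  apply: (@MVT_segment R sin cos 0 y y0).
  by apply: continuous_subspaceT => x; exact: continuous_sin.
by rewrite sin0 !subr0 => ->; rewrite ler_piMl// cos_le1.
Qed.

Lemma expr_lower_bound (R : realType) (n : nat) (a b e : R) :
  0 <= a -> a <= e -> b <= a ^+ n -> b <= e ^+ n.
Proof.
move=> a0 ae ba; apply: (le_trans ba).
by apply: lerXn2r => //; rewrite nnegrE // (le_trans a0).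
Qed.

(** From cos (pi / 2) = 0 by halving the angle twice, with sin y <= y. *)
Lemma pi_ge305 (R : realType) : 61 / 20 <= pi :> R.
Proof.
rewrite leNgt; apply/negP => pi3.
have p0 : 0 < pi :> R := pi_gt0 R.
have c4 : cos (pi / 4 : R) ^+ 2 = 1 / 2.
  have := cos_mulr2n (pi / 4 : R).
  rewrite (_ : pi / 4 *+ 2 = pi / 2); last by field.
  by rewrite cos_pihalf => ?; lra.
have c8 := cos_mulr2n (pi / 8 : R).
rewrite (_ : pi / 8 *+ 2 = pi / 4) in c8; last by field.
have s8 : 0 <= sin (pi / 8 : R) by apply: sin_ge0_pi; lra.
have s8' : sin (pi / 8 : R) <= 61 / 160.
  by apply: (le_trans (sin_le_id _)); lra.
have := cos2Dsin2 (pi / 8 : R).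
have h1 : sin (pi / 8 : R) ^+ 2 <= 61 / 160 * (61 / 160).
  by rewrite expr2; exact: ler_pM.
move=> h2.
have : 502 / 1000 <= cos (pi / 4 : R) ^+ 2.
  by apply: (expr_lower_bound (a := 709 / 1000)); lra.
by rewrite c4; lra.
Qed.

Lemma expR_two_thirds_le2 (R : realType) : expR (2 / 3) <= 2 :> R.
Proof.
have h : 1 / 2 <= expR (- (2 / 3)) :> R.
  (* exp (- 2 / 3) >= (17 / 18)^12 > 1 / 2 *)
  rewrite (_ : - (2 / 3) = 12%:R * (- (1 / 18))); last by field.
  rewrite expRM_natl; set e := expR _.
  have e1 : 17 / 18 <= e by have := expR_ge1Dx (- (1 / 18) : R); rewrite -/e; lra.
  have e3 : 842 / 1000 <= e ^+ 3.
    by apply: (expr_lower_bound (a := 17 / 18)); lra.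
  have e6 : 708 / 1000 <= (e ^+ 3) ^+ 2.
    by apply: (expr_lower_bound (a := 842 / 1000)); lra.
  have e12 : 1 / 2 <= ((e ^+ 3) ^+ 2) ^+ 2.
    by apply: (expr_lower_bound (a := 708 / 1000)); lra.
  by rewrite -!exprM in e12.
by move: h; rewrite expRN -[1 / 2]invf_div divr1 lef_pV2 ?posrE ?expR_gt0.
Qed.

Lemma ln2_ge (R : realType) : 2 / 3 <= ln 2 :> R.
Proof. by rewrite -(expRK (2 / 3)) ler_ln ?posrE ?expR_gt0 ?expR_two_thirds_le2. Qed.

Lemma sqrt2_le_expR_5_14 (R : realType) : Num.sqrt 2 <= expR (5 / 14) :> R.
Proof.
rewrite -(@ler_pXn2r _ 2) ?nnegrE ?expR_ge0 ?sqrtr_ge0// sqr_sqrtr//.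
(* exp (5 / 7) >= (1 + 5 / 147)^21 > 2 *)
rewrite -expRM_natl (_ : 2%:R * (5 / 14) = 21%:R * (5 / 147)); last by field.
rewrite expRM_natl; set e := expR _.
have e1 : 1034 / 1000 <= e by have := expR_ge1Dx (5 / 147 : R); rewrite -/e; lra.
have : 1105 / 1000 <= e ^+ 3.
  by apply: (expr_lower_bound (a := 1034 / 1000)); lra.
rewrite (_ : e ^+ 21 = (e ^+ 3) ^+ 7); last by rewrite -exprM.
move: (e ^+ 3) => y y1.
have y2 : 1221 / 1000 <= y ^+ 2.
  by apply: (expr_lower_bound (a := 1105 / 1000)); lra.
have y4 : 1490 / 1000 <= (y ^+ 2) ^+ 2.
  by apply: (expr_lower_bound (a := 1221 / 1000)); lra.
have -> : y ^+ 7 = (y ^+ 2) ^+ 2 * (y ^+ 2 * y) by ring.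
move: y2 y4; move: (y ^+ 2) => z; move: (z ^+ 2) => u z1 u1.
have zy : 1349 / 1000 <= z * y.
  have z0 : 0 <= 1221 / 1000 :> R by lra.
  have y0 : 0 <= 1105 / 1000 :> R by lra.
  by have := ler_pM z0 y0 z1 y1; lra.
have u0 : 0 <= 1490 / 1000 :> R by lra.
have zy0 : 0 <= 1349 / 1000 :> R by lra.
by have := ler_pM u0 zy0 u1 zy; lra.
Qed.

(** Both sides are (q - 1) (e - 1) times a geometric sum. *)
Lemma geometric_ratio_le (R : realType) (q e : R) (s : nat) : 1 <= q -> q <= e ->
  (q ^+ s - 1) * (e - 1) <= (e ^+ s - 1) * (q - 1).
Proof.
move=> q1 qe; rewrite !subrX1 mulrAC [X in _ <= X]mulrAC [(e - 1) * (q - 1)]mulrC.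
rewrite ler_wpM2l//; first by rewrite mulr_ge0// subr_ge0// (le_trans q1).
apply: ler_sum => i _; rewrite lerXn2r// nnegrE ?(le_trans _ q1)//.
by rewrite (le_trans _ qe)// (le_trans _ q1).
Qed.

(** The first bound takes q = 301 / 300, close to 1, and the second one
    q = sqrt 2, the minimizer of q exp (- (1 - 1 / q^2)); it relies on
    sqrt 2 <= exp (1 / 2 - 1 / 7). *)
Lemma chi_square_tail_le (R : realType) (s : nat) (p : R) : (0 < s)%N ->
  (forall q, 1 < q -> 1 + (expR (1 - q ^- 2) ^+ s - 1) * p <= q ^+ s) ->
  p <= 503 / 1000 /\ p < expR (- (s%:R / 7)).
Proof.
move=> s0 H; split.
  pose q : R := 301 / 300; have q1 : 1 < q by rewrite /q; lra.
  pose e := expR (1 - q ^- 2).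
  have qq : 1 - q ^- 2 = (q - 1) * (q + 1) / q ^+ 2 by field; rewrite gt_eqF//; lra.
  have eE : 1 + (1 - q ^- 2) <= e by exact: expR_ge1Dx.
  have q20 : 0 < q ^+ 2 by rewrite exprn_gt0//; lra.
  have qe : q <= e.
    apply: le_trans eE; rewrite qq -lerBlDl ler_pdivlMr//.
    by rewrite ler_wpM2l//; rewrite /q; lra.
  have e1 : 0 < e - 1 by lra.
  have es1 : 0 < e ^+ s - 1 by rewrite subr_gt0 exprn_egt1 -?lt0n//; lra.
  have h := H _ q1; rewrite -/e in h.
  have g := geometric_ratio_le s (ltW q1) qe.
  have h1 : (e ^+ s - 1) * (p * (e - 1)) <= (e ^+ s - 1) * (q - 1).
    apply: le_trans g; rewrite mulrA ler_wpM2r//; first exact: ltW.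
    by lra.
  rewrite ler_pM2l// in h1.
  rewrite leNgt; apply/negP => p_gt.
  have k0 : 0 <= 503 / 1000 :> R by lra.
  have d0 : 0 <= (q - 1) * (q + 1) / q ^+ 2.
    by rewrite -qq subr_ge0 invf_le1// exprn_ege1// ltW.
  have h2 : 503 / 1000 * ((q - 1) * (q + 1) / q ^+ 2) <= p * (e - 1).
    by apply: ler_pM => //; [exact: ltW|rewrite -qq; lra].
  have := le_trans h2 h1; rewrite mulrA ler_pdivrMr//.
  by rewrite /q; lra.
pose q : R := Num.sqrt 2.
have q1 : 1 < q by rewrite -sqrtr1 ltr_sqrt//; lra.
have q2 : q ^+ 2 = 2 by exact: sqr_sqrtr.
have h := H _ q1; rewrite q2 in h.
pose f : R := expR (- (1 / 7)); pose e : R := expR (1 - 2^-1).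
have fE : expR (- (s%:R / 7)) = f ^+ s.
  by rewrite -expRM_natl; congr expR; field.
have fe : q <= f * e.
  rewrite -expRD (_ : - (1 / 7) + _ = 5 / 14); last by field.
  exact: sqrt2_le_expR_5_14.
have f1 : f ^+ s < 1.
  rewrite exprn_ilt1 -?lt0n// ?expR_ge0//.
  by rewrite -[ltRHS]expR0 ltr_expR; lra.
have e1 : 1 < e by rewrite -[ltLHS]expR0 ltr_expR; lra.
have es1 : 0 < e ^+ s - 1 by rewrite subr_gt0 exprn_egt1 -?lt0n//.
rewrite fE -(ltr_pM2l es1).
have qs : q ^+ s <= f ^+ s * e ^+ s.
  by rewrite -exprMn lerXn2r// nnegrE ?sqrtr_ge0// mulr_ge0 ?expR_ge0.
rewrite -/e in h.
by lra.
Qed.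

(** The quantity bounded here is sqrt (2 / pi) / x, the factor that Mills'
    inequality gains over exp (- x^2 / 2) for the two-sided tail. *)
Lemma mills_ratio (R : realType) (x l : R) : 0 < x -> x ^+ 2 >= 2 * l ->
  (2 / 3 <= l -> 2 * (x^-1 * (Num.sqrt (pi *+ 2))^-1) < 1) /\
  (4 / 3 <= l -> 2 * (x^-1 * (Num.sqrt (pi *+ 2))^-1) <= 497 / 1000).
Proof.
move=> x0 xl; set c := Num.sqrt _.
have p3 := pi_ge305 R.
have c0 : 0 < c by rewrite sqrtr_gt0 mulrn_wgt0 ?pi_gt0.
have c2 : c ^+ 2 = pi *+ 2 by rewrite sqr_sqrtr// mulrn_wge0 ?pi_ge0.
have c6 : 61 / 10 <= c ^+ 2 by rewrite c2 mulr2n; lra.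
have c60 : 0 <= 61 / 10 :> R by lra.
have rE : 2 * (x^-1 * c^-1) = 2 / (x * c) by field; rewrite !gt_eqF.
have : 0 < x * c by exact: mulr_gt0.
have yE : (x * c) * (x * c) = x ^+ 2 * c ^+ 2 by ring.
rewrite rE; move: (x * c) yE => y yE y0; split => hl.
  rewrite ltr_pdivrMr// mul1r ltNge; apply/negP => y2.
  have yy : y * y <= 2 * 2 by apply: ler_pM => //; exact: ltW.
  have l2 : 4 / 3 <= x ^+ 2 by lra.
  have l0 : 0 <= 4 / 3 :> R by lra.
  by have := ler_pM l0 c60 l2 c6; lra.
rewrite ler_pdivrMr// leNgt; apply/negP => y2.
have l2 : 8 / 3 <= x ^+ 2 by lra.
have l0 : 0 <= 8 / 3 :> R by lra.
have y2' : y <= 4025 / 1000 by lra.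
have yy : y * y <= 4025 / 1000 * (4025 / 1000).
  exact: (ler_pM (ltW y0) (ltW y0) y2' y2').
by have := ler_pM l0 c60 l2 c6; lra.
Qed.

(** * Recovery error of basis pursuit denoising *)

Theorem corollary1 (R : realType) (d : measure_display) (T : measurableType d)
    (P : probability T R) (n m s : nat) (A : 'M[R]_(n, m)) (x0 : 'cV[R]_m)
    (sigma alpha gamma : R) (w : 'I_n -> {RV P >-> R}) (b : T -> 'cV[R]_n)
    (xBP : T -> 'cV[R]_m)
    (hnm : (n < m)%N)
    (hA : forall i : 'I_m, l2norm (col i A) = 1)
    (hx0 : l0norm x0 = s)
    (hsigma : 0 < sigma)
    (hw : white_gaussian w sigma)
    (hb : forall t : T, b t = A *m x0 + \col_(i < n) w i t)
    (hs : s%:R < 1 / (3 * mutual_coherence A))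
    (halpha : 0 < alpha)
    (hgamma : gamma =
       Num.sqrt (8 * sigma ^+ 2 * (1 + alpha) * ln ((m - s)%:R : R)))
    (hxBP : forall t : T, is_bpdn_solution A (b t) gamma (xBP t)) :
  holds_with_prob_gt P
    ((1 - 1 / ((m - s)%:R `^ alpha)) * (1 - expR (- (s%:R / 7))))
    [set t : T | l2norm (x0 - xBP t) ^+ 2 <=
       (Num.sqrt 3 + 3 * Num.sqrt (2 * (1 + alpha) * ln ((m - s)%:R : R))) ^+ 2
         * s%:R * sigma ^+ 2].
Proof.
set mu := mutual_coherence A in hs.
have unit_cols i : dot (col i A) (col i A) = 1.
  by rewrite -l2norm_sqr hA expr1n.
have coherence i j : i != j -> `|dot (col i A) (col j A)| <= mu.
  exact: dot_col_coherence.
(* For mu = 0 the bound on s would read s < 1 / 0 = 0. *)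
have mu0 : 0 < mu.
  have mu_ge0 : 0 <= mu by exact: bigmax_ge_id.
  rewrite lt_neqAle mu_ge0 andbT eq_sym; apply: contraTneq hs => ->.
  by rewrite mulr0 invr0 mulr0 -leNgt ler0n.
have small : 3 * s%:R * mu < 1.
  move: hs; rewrite ltr_pdivlMr ?mulr_gt0// => h.
  by rewrite (mulrC 3) -mulrA.
have dims := coherence_sparsity_dim unit_cols coherence (ltW mu0) hnm small.
set L := [set i : 'I_m | x0 i 0 != 0]%SET.
have cardL : #|L| = s by [].
have x0L : supported_on L x0 by move=> i; rewrite inE negbK => /eqP.
have [us [ous sus cus pus]] := gram_schmidt_columns A (enum L).
have cus' u : u \in us -> exists2 c : 'cV[R]_m, supported_on L c & u = A *m c.
  by move=> /cus[c cL ->]; exists c => // i iL; apply: cL; rewrite mem_enum.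
have pus' i : i \in L -> proj_span us (col i A) = col i A.
  by move=> iL; apply: pus; rewrite mem_enum.
rewrite -cardE cardL in sus.
set M := (m - s)%N in hgamma *; set l := ln (M%:R : R) in hgamma *.
have M2 : (2 <= M)%N by rewrite /M; lia.
have M4 : (0 < s)%N -> (4 <= M)%N by rewrite /M; lia.
have MR0 : 0 < M%:R :> R by rewrite ltr0n; lia.
have l2 : 2 / 3 <= l.
  by apply: (le_trans (ln2_ge R)); rewrite ler_ln ?posrE// ler_nat.
have l4 : (0 < s)%N -> 4 / 3 <= l.
  move=> /M4 M4'; apply: (@le_trans _ _ (ln (2 ^+ 2))).
    by rewrite lnXn// mulr2n; have := ln2_ge R; lra.
  by rewrite ler_ln ?posrE ?exprn_gt0// -natrX ler_nat.
set x := Num.sqrt (2 * (1 + alpha) * l).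
have al0 : 0 < alpha * l by rewrite mulr_gt0//; lra.
have x2 : x ^+ 2 = 2 * (1 + alpha) * l by rewrite sqr_sqrtr//; lra.
have xpos : 0 < x by rewrite sqrtr_gt0; lra.
have gE : gamma = 2 * (x * sigma).
  rewrite hgamma (_ : 8 * _ * _ * l = (2 * (x * sigma)) ^+ 2); last first.
    by rewrite !exprMn x2; ring.
  by rewrite sqrtr_sqr gtr0_norm// !mulr_gt0.
have g0 : 0 < gamma by rewrite gE !mulr_gt0.
have xl : 2 * l <= x ^+ 2 by rewrite x2; lra.
have [r1 r4] := mills_ratio xpos xl.
set r := 2 * (x^-1 * _) in r1 r4.
pose theta i := col i A - proj_span us (col i A).
have theta1 i : dot (theta i) (theta i) <= 1.
  by rewrite -(unit_cols i); exact: dot_residual_le.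
have [E [mE E_good PE]] := good_noise_event hsigma hw [pred i | i \notin L] us
  (2 * s%:R * sigma ^+ 2) theta1 xpos.
exists E; split => //.
  move=> t /E_good[noise_small proj_small] /=.
  rewrite l2norm_sqr.
  have proj_noise : dot (proj_span us (noise_vector w t))
      (proj_span us (noise_vector w t)) <= 2 * sigma ^+ 2 * #|L|%:R.
    by rewrite dot_proj_span// cardL mulrAC.
  have small' : 3 * #|L|%:R * mu < 1 by rewrite cardL.
  have s20 : 0 < sigma ^+ 2 by rewrite exprn_gt0.
  have noise_small' i : i \notin L ->
      `|dot (theta i) (noise_vector w t)| <= gamma / 2.
    by move=> /noise_small; rewrite gE mulrAC divff// mul1r.
  have := bpdn_solution_error unit_cols coherence (ltW mu0) g0 (hxBP t) ous cus'
    pus' small' x0L (hb t) noise_small' proj_noise s20.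
  rewrite cardL gE sqrtrM// sqrtr_sqr gtr0_norm// => h; apply: (le_trans h).
  rewrite le_eqVlt; apply/orP; left; apply/eqP.
  by field.
apply: lt_le_trans PE; rewrite lte_fin.
set p2 := fine _.
set a := 1 / _; set bb := expR (- (s%:R / 7)).
have aE : a = expR (- (alpha * l)).
  by rewrite /a /powR gt_eqF// -/l expRN div1r.
have a0 : 0 < a by rewrite aE expR_gt0.
have a1 : a < 1 by rewrite aE -[ltRHS]expR0 ltr_expR; lra.
have cardM : #|[pred i | i \notin L]| = M.
  have := cardC (mem L); rewrite card_ord cardL => mE'.
  have -> : M = #|[predC L]| by rewrite /M -[X in (X - _)%N]mE' addKn.
  by apply: eq_card => i; rewrite !inE.
have tailE : M%:R * (2 * (x^-1 * (Num.sqrt (pi *+ 2))^-1 *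
    expR (- x ^+ 2 / 2))) = r * a.
  have -> : - x ^+ 2 / 2 = - l + - (alpha * l) by rewrite x2; field.
  rewrite expRD -aE expRN lnK ?posrE//.
  have gen (y c z e : R) : y != 0 -> y * (2 * (z * c * (y^-1 * e))) = 2 * (z * c) * e.
    by move=> y0; field.
  by apply: gen; rewrite gt_eqF.
rewrite cardM tailE.
have [pb prp] : p2 < bb /\ r + p2 <= 1.
  have [s0|s0] := posnP s.
    have p20 : p2 = 0.
      rewrite /p2 (_ : [set t | _] = set0) ?measure0//.
      apply/seteqP; split=> t //=; rewrite s0 mulr0 mul0r.
      by move: sus; rewrite s0 leqn0 size_eq0 => /eqP->; rewrite big_nil ltxx.
    rewrite p20 /bb s0 mul0r oppr0 expR0 addr0; split => //.
    by apply: ltW; apply: r1; lra.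
  have [] := chi_square_tail_le (p := p2) s0.
    by move=> q q1; exact: sum_sqr_dot_noise_tail.
  move=> h1 h2; split => //.
  by have := r4 (l4 s0); lra.
(* r a + p2 < 1 - (1 - a) (1 - bb) splits as (1 - a) (bb - p2) +
   a (1 - r - p2) > 0. *)
have h1 : 0 < (1 - a) * (bb - p2) by rewrite mulr_gt0// subr_gt0.
have h2 : 0 <= a * (1 - r - p2) by rewrite mulr_ge0 ?(ltW a0)//; lra.
by lra.
Qed.
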